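(* Assume that the reduced system $G(p,x)\in K$ enjoys Robinson stability at $(\bar p,\bar x)$, and that strict complementarity holds for the system $G(\bar p,x)\in K$ at $(\bar x,\bar x^* )$. Then for every $v=(q,u)\in{\cal P}\times X$, $$D\Psi(\bar p,\bar x,\bar x^* )(v)\subset\bigcup\Big\{\nabla(\nabla_xG(\cdot)^*\hat\mu)(\bar z)v+\pi_{X^*}\big(N_{{\cal K}_{\operatorname{gph}\Gamma}(\bar z,z^* )}(v)\big)\ \Big|\ z^*\in N_{T_{\operatorname{gph}\Gamma}(\bar z)}(v),\ \pi_{X^*}(z^* )=\bar x^*,\ \hat\mu\in{\cal M}(\bar z,z^* )\Big\}.$$ If moreover $\nabla^2G(\bar z)(v,v)\in\operatorname{rge}\nabla G(\bar z)+\operatorname{lin}K$, then this inclusion holds as an equality.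
   Context: Notation: $X=\mathbb R^n$, $P=\mathbb R^m$, $Y=\mathbb R^l$, $Z:=P\times X$, and $E$ is finite-dimensional. Dual spaces are distinguished from primal ones, $Z^*=P^*\times X^*$, and $\pi_{X^*}(p^*,x^* ):=x^*$. $A^*$ denotes the adjoint of a linear map $A$, and $\operatorname{rge}A$ its range. For $\mu\in E^*$, $\nabla(\nabla_xG(\cdot)^*\mu)(\bar z)v\in X^*$ is the derivative at $\bar z$ of the map $z\mapsto\nabla_xG(z)^*\mu$, applied to $v$. For a cone $A$, $A^*:=\{a^*:\langle a^*,a\rangle\le0\ \forall a\in A\}$ is its polar, and for a closed convex cone $K$, $\operatorname{lin}K:=K\cap(-K)$; $\operatorname{ri}$ is the relative interior. For a closed set $\Omega$ and $\bar z\in\Omega$: the tangent cone is $T_\Omega(\bar z):=\{w:\exists\, t_k\downarrow0,\ w_k\to w \text{ with } \bar z+t_kw_k\in\Omega\}$; the regular normal cone is $N_\Omega(\bar z):=\{z^*:\limsup_{z\to\bar z,\,z\in\Omega}\langle z^*,z-\bar z\rangle/\|z-\bar z\|\le0\}$ (for convex sets, this is the normal cone of convex analysis); and, for $z^*\in N_\Omega(\bar z)$, the critical cone is ${\cal K}_\Omega(\bar z,z^* ):=T_\Omega(\bar z)\cap\{z^*\}^\perp$. For a set-valued map $\Phi$, the graphical derivative is $D\Phi(\bar z,\bar u)(w):=\{v:(w,v)\in T_{\operatorname{gph}\Phi}(\bar z,\bar u)\}$. Setting: $g\colon P\times X\to Y$ is $C^2$ around $\bar z=(\bar p,\bar x)$.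 The set $C\subset Y$ is closed and $C^2$-cone reducible at $g(\bar z)$ to a closed convex cone $K\subset E$: there exist a neighborhood $V$ of $g(\bar z)$ and a $C^2$ map $h\colon V\to E$ with $h(g(\bar z))=0$, $\nabla h(g(\bar z))$ surjective, and $C\cap V=\{y\in V:h(y)\in K\}$. Set $\Gamma(p):=\{x:g(p,x)\in C\}$ with $\bar x\in\Gamma(\bar p)$, $\Psi(p,x):=N_{\Gamma(p)}(x)$, and fix $\bar x^*\in N_{\Gamma(\bar p)}(\bar x)$. Let $G:=h\circ g$, defined near $\bar z$, so that $G(\bar z)=0$. Near $\bar z$, $\operatorname{gph}\Gamma$ coincides with $\{z:G(z)\in K\}$, and for $p$ near $\bar p$, $\Gamma(p)$ coincides near $\bar x$ with $\{x:G(p,x)\in K\}$. The system $G(p,x)\in K$ enjoys Robinson stability (RS) at $(\bar p,\bar x)$ if there are $\kappa\ge0$ and neighborhoods $W$ of $\bar p$ and $U$ of $\bar x$ with ${\rm dist}(x;\{x':G(p,x')\in K\})\le\kappa\,{\rm dist}(G(p,x);K)$ for all $(p,x)\in W\times U$. Strict complementarity holds for $G(\bar p,x)\in K$ at $(\bar x,\bar x^* )$ if there is $\mu\in\operatorname{ri}K^*$ with $\nabla_xG(\bar z)^*\mu=\bar x^*$. Multiplier sets: for $z^*\in N_{\operatorname{gph}\Gamma}(\bar z)$, ${\cal M}(\bar z,z^* ):=\{\mu\in K^*:\nabla G(\bar z)^*\mu=z^*\}$. The characteristic subspace is ${\cal P}:=\{q\in P:\nabla_pG(\bar z)q\in\operatorname{rge}\nabla_xG(\bar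 z)+\operatorname{lin}K\}$. *)

(* Defs.v *)
From mathcomp Require Import all_boot.
From Stdlib Require Import Reals.
Set Implicit Arguments. Unset Strict Implicit. Unset Printing Implicit Defensive.
Local Open Scope R_scope.

(** * Finite-dimensional Euclidean spaces  R^I  (I a finite index type).
    Dual spaces are identified with the primal ones via the standard
    inner product, so a dual vector is again an element of [Vec I]. *)
Definition Vec (I : finType) := I -> R.
Definition Mat (J I : finType) := J -> I -> R.

(** Index type of Z = P x X with P = R^m, X = R^n. *)
Notation ZI m n := ('I_m + 'I_n)%type.

Definition vsum {I : finType} (F : I -> R) : R := \big[Rplus/R0]_(i : I) F i.
Definition vzero {I : finType} : Vec I := fun _ => 0.
Definition vadd {I : finType} (u v : Vec I) : Vec I := fun i => u i + v i.
Definition vopp {I : finType} (u : Vec I) : Vec I := fun i => - u i.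
Definition vsub {I : finType} (u v : Vec I) : Vec I := fun i => u i - v i.
Definition vscale {I : finType} (t : R) (u : Vec I) : Vec I := fun i => t * u i.
Definition inner {I : finType} (u v : Vec I) : R := vsum (fun i => u i * v i).
Definition norm {I : finType} (u : Vec I) : R := sqrt (inner u u).

Definition mapply {J I : finType} (M : Mat J I) (v : Vec I) : Vec J :=
  fun j => vsum (fun i => M j i * v i).
Definition tapply {J I : finType} (M : Mat J I) (w : Vec J) : Vec I :=
  fun i => vsum (fun j => M j i * w j).

Definition vpair {I J : finType} (a : Vec I) (b : Vec J) : Vec (I + J)%type :=
  fun k => match k with inl i => a i | inr j => b j end.
Definition vfst {I J : finType} (w : Vec (I + J)%type) : Vec I := fun i => w (inl i).
Definition vsnd {I J : finType} (w : Vec (I + J)%type) : Vec J := fun j => w (inr j).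

Definition is_open {I : finType} (S : Vec I -> Prop) : Prop :=
  forall x, S x -> exists eps, 0 < eps /\ forall y, norm (vsub y x) < eps -> S y.
Definition is_closed {I : finType} (S : Vec I -> Prop) : Prop :=
  forall x, (forall eps, 0 < eps -> exists y, S y /\ norm (vsub y x) < eps) -> S x.

Definition fderiv {I J : finType} (f : Vec I -> Vec J) (x : Vec I) (M : Mat J I) : Prop :=
  forall eps, 0 < eps -> exists delta, 0 < delta /\
    forall y, norm (vsub y x) < delta ->
      norm (vsub (vsub (f y) (f x)) (mapply M (vsub y x))) <= eps * norm (vsub y x).

Definition vcont_at {I J : finType} (F : Vec I -> Vec J) (x : Vec I) : Prop :=
  forall eps, 0 < eps -> exists delta, 0 < delta /\
    forall y, norm (vsub y x) < delta -> norm (vsub (F y) (F x)) < eps.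

Definition mat2vec {J I : finType} (M : Mat J I) : Vec (J * I)%type :=
  fun ji => M ji.1 ji.2.
Definition ten2mat {J I : finType} (T : J -> I -> I -> R) : Mat (J * I)%type I :=
  fun ji k => T ji.1 ji.2 k.
Definition ten2vec {J I : finType} (T : J -> I -> I -> R) : Vec (J * I * I)%type :=
  fun jik => T jik.1.1 jik.1.2 jik.2.

(** [C2_on U f Df D2f]: on the (open) set U, f is differentiable with
    Jacobian [Df z] (entry (j,i) = d f_j / d z_i), the Jacobian map is
    differentiable with derivative [D2f z] (entry (j,i,k) = d^2 f_j/dz_k dz_i),
    and [D2f] is continuous. *)
Definition C2_on {I J : finType} (U : Vec I -> Prop) (f : Vec I -> Vec J)
  (Df : Vec I -> Mat J I) (D2f : Vec I -> J -> I -> I -> R) : Prop :=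
  forall z, U z ->
    fderiv f z (Df z) /\
    fderiv (fun y => mat2vec (Df y)) z (ten2mat (D2f z)) /\
    vcont_at (fun y => ten2vec (D2f y)) z.

Definition C2_around {I J : finType} (f : Vec I -> Vec J) (x : Vec I)
  (Df : Vec I -> Mat J I) (D2f : Vec I -> J -> I -> I -> R) : Prop :=
  exists delta, 0 < delta /\ C2_on (fun z => norm (vsub z x) < delta) f Df D2f.

Definition surjective_mat {J I : finType} (M : Mat J I) : Prop :=
  forall e : Vec J, exists y : Vec I, forall j, mapply M y j = e j.

Definition is_cone {I : finType} (K : Vec I -> Prop) : Prop :=
  K vzero /\ forall a t, K a -> 0 <= t -> K (vscale t a).
Definition is_convex {I : finType} (K : Vec I -> Prop) : Prop :=
  forall a b t, K a -> K b -> 0 <= t <= 1 ->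
    K (vadd (vscale t a) (vscale (1 - t) b)).

Definition polar {I : finType} (A : Vec I -> Prop) : Vec I -> Prop :=
  fun y => forall a, A a -> inner y a <= 0.
Definition lin {I : finType} (K : Vec I -> Prop) : Vec I -> Prop :=
  fun a => K a /\ K (vopp a).

Definition aff_hull {I : finType} (S : Vec I -> Prop) : Vec I -> Prop :=
  fun y => exists l : list (R * Vec I),
    List.Forall (fun c => S (snd c)) l /\
    List.fold_right (fun c acc => fst c + acc) 0 l = 1 /\
    forall i, y i = List.fold_right (fun c acc => fst c * snd c i + acc) 0 l.
Definition rel_interior {I : finType} (S : Vec I -> Prop) : Vec I -> Prop :=
  fun x => S x /\ exists eps, 0 < eps /\
    forall y, aff_hull S y -> norm (vsub y x) < eps -> S y.

Definition tangent_cone {I : finType} (S : Vec I -> Prop) (x : Vec I) : Vec I -> Prop :=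
  fun w => exists (t : nat -> R) (wk : nat -> Vec I),
    (forall k, 0 < t k) /\ Un_cv t 0 /\
    Un_cv (fun k => norm (vsub (wk k) w)) 0 /\
    forall k, S (vadd x (vscale (t k) (wk k))).

Definition reg_normal {I : finType} (S : Vec I -> Prop) (x : Vec I) : Vec I -> Prop :=
  fun xs => S x /\ forall eps, 0 < eps -> exists delta, 0 < delta /\
    forall z, S z -> norm (vsub z x) < delta ->
      inner xs (vsub z x) <= eps * norm (vsub z x).

Definition crit_cone {I : finType} (S : Vec I -> Prop) (x xs : Vec I) : Vec I -> Prop :=
  fun w => tangent_cone S x w /\ inner xs w = 0.

(** [dist_le S x r] :  dist(x; S) <= r  (with dist(x; emptyset) = +infinity). *)
Definition dist_le {I : finType} (S : Vec I -> Prop) (x : Vec I) (r : R) : Prop :=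
  forall eps, 0 < eps -> exists y, S y /\ norm (vsub x y) < r + eps.

Section Objects.
Context {m n l : nat}.

Definition Gamma (C : Vec 'I_l -> Prop) (g : Vec (ZI m n) -> Vec 'I_l)
  (p : Vec 'I_m) : Vec 'I_n -> Prop := fun x => C (g (vpair p x)).
Definition gphGamma (C : Vec 'I_l -> Prop) (g : Vec (ZI m n) -> Vec 'I_l)
  : Vec (ZI m n) -> Prop := fun z => C (g z).
Definition gphPsi (C : Vec 'I_l -> Prop) (g : Vec (ZI m n) -> Vec 'I_l)
  : Vec (ZI m n + 'I_n)%type -> Prop :=
  fun w => reg_normal (Gamma C g (vfst (vfst w))) (vsnd (vfst w)) (vsnd w).
Definition DPsi (C : Vec 'I_l -> Prop) (g : Vec (ZI m n) -> Vec 'I_l)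
  (zbar : Vec (ZI m n)) (xs : Vec 'I_n) (v : Vec (ZI m n)) : Vec 'I_n -> Prop :=
  fun us => tangent_cone (gphPsi C g) (vpair zbar xs) (vpair v us).
End Objects.

Section Reduced.
Context {m n d : nat}.

Definition grad_x (M : Mat 'I_d (ZI m n)) : Mat 'I_d 'I_n := fun e j => M e (inr j).
Definition grad_p (M : Mat 'I_d (ZI m n)) : Mat 'I_d 'I_m := fun e i => M e (inl i).

(** nabla( nabla_x G(.)^* mu )(zbar) v, given the second derivative
    [D2 = nabla^2 G(zbar)] (D2 e i k = d^2 G_e / dz_k dz_i). *)
Definition hess_x_mult (D2 : 'I_d -> ZI m n -> ZI m n -> R) (mu : Vec 'I_d)
  (v : Vec (ZI m n)) : Vec 'I_n :=
  fun j => vsum (fun e => mu e * vsum (fun k => D2 e (inr j) k * v k)).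
Definition hess_vv (D2 : 'I_d -> ZI m n -> ZI m n -> R) (v : Vec (ZI m n)) : Vec 'I_d :=
  fun e => vsum (fun i => vsum (fun k => D2 e i k * v i * v k)).

Definition in_rge_plus_lin {I : finType} (M : Mat 'I_d I) (K : Vec 'I_d -> Prop)
  (y : Vec 'I_d) : Prop :=
  exists (a : Vec I) (k : Vec 'I_d), lin K k /\ forall e, y e = mapply M a e + k e.

(** multiplier set  M(zbar, zs) = {mu in polar K : nabla G(zbar)^T mu = zs},
    with [M = nabla G(zbar)] *)
Definition multipliers (K : Vec 'I_d -> Prop) (M : Mat 'I_d (ZI m n))
  (zs : Vec (ZI m n)) : Vec 'I_d -> Prop :=
  fun mu => polar K mu /\ forall i, tapply M mu i = zs i.

Definition char_subspace (K : Vec 'I_d -> Prop) (M : Mat 'I_d (ZI m n)) : Vec 'I_m -> Prop :=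
  fun q => in_rge_plus_lin (grad_x M) K (mapply (grad_p M) q).

Definition robinson_stable (G : Vec (ZI m n) -> Vec 'I_d) (K : Vec 'I_d -> Prop)
  (pbar : Vec 'I_m) (xbar : Vec 'I_n) : Prop :=
  exists kappa dW dU, 0 <= kappa /\ 0 < dW /\ 0 < dU /\
    forall p x, norm (vsub p pbar) < dW -> norm (vsub x xbar) < dU ->
      (* dist(x; {x' : G(p,x') in K}) <= kappa * dist(G(p,x); K) *)
      forall k, K k ->
        dist_le (fun x' => K (G (vpair p x'))) x (kappa * norm (vsub (G (vpair p x)) k)).

(** strict complementarity for  G(pbar,x) in K  at (xbar, xs), with [M = nabla G(zbar)] *)
Definition strict_compl (K : Vec 'I_d -> Prop) (M : Mat 'I_d (ZI m n)) (xs : Vec 'I_n) : Prop :=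
  exists mu, rel_interior (polar K) mu /\ forall j, tapply (grad_x M) mu j = xs j.
End Reduced.

(* Main.v *)
Require Import Defs.
From mathcomp Require Import all_boot.
From Stdlib Require Import Reals.
From HB Require Import structures.
From Stdlib Require Import Lra FunctionalExtensionality Classical ClassicalEpsilon.
Set Implicit Arguments. Unset Strict Implicit. Unset Printing Implicit Defensive.
Delimit Scope nat_scope with N.
Local Open Scope R_scope.

(** Write [A] for the Jacobian of [G] at the reference point, [A_x] for its [x]-part and [L = lin K].

    Robinson stability linearizes the constraints: the tangent cone of [gph Gamma] is [A^-1(K)], and
    every normal to [Gamma(p)] at a nearby point has a multiplier bounded by a multiple of its norm.
    For [q] in the characteristic subspace all multipliers of [xs] take the same value at [A(q,u)], so
    the strict complementarity multiplier [mub] puts [A(q,u)] in [L].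

    Inclusion: along a tangent sequence the multipliers [mu_k] cluster at some [mu], and
    [(mu_k - mu)/t_k] has the same image under [A_x^*] as an element of [K^* - R_+ mub]. This set is a
    subspace because [mub] lies in [ri K^*], so its image is closed and contains the limit
    [A_x^*(nu - c mub) = A_x^*(nu - c mu)]; finally [A^*(nu - c mu)] is normal to the critical cone.

    Equality: the second-order condition provides a parabolic arc along which [G] stays [o(t^2)]-close
    to [L]. Projecting the arc shifted by [(xs + t w)/rho] onto [Gamma(p_t)] gives points with
    proximal normals [xs + t(w - rho y)], where [t y] is the displacement from the arc. For [rho] large
    a second-order expansion along the given multiplier forces [y] to tend to [0]. *)

(** In the inclusion, the quotients [(mu_k - mub)/t_k] may be unbounded: only their images under
    [A_x^*] converge, and a linear image of a closed cone need not be closed. Hence the detour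
    through a subspace instead of a limit of multipliers. The limit is then rewritten with [mu] in
    place of [mub]: both have the same image under [A_x^*], but it is [A^* mu] that defines the
    critical cone.

    In the equality, the parameter may bend with the arc: a tangent sequence only asks that
    [(p_t - pbar)/t] tend to [q], so the term of order [t^2] that cancels the curvature of [G] may
    use the full range of [A] rather than that of [A_x]. Normals at the moving points come from
    projections because a nearest point determines its proximal normal explicitly, whereas a
    multiplier prescribed in advance would have to be complementary to the value of [G] at the new
    point. The price is nonconvexity: the displacement is controlled only up to second-order terms,
    which the weight [rho] has to dominate. *)

HB.instance Definition _ := Monoid.isComLaw.Build R R0 Rplus
  (fun x y z => esym (Rplus_assoc x y z)) Rplus_comm Rplus_0_l.

(* Writing [Vec 'I_n] leaves [reverse_coercion] marks in types, which the arithmetic tactics do not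
   see through. *)
Ltac vring := apply: functional_extensionality => ?;
  rewrite /vadd /vsub /vscale /vopp /vzero /=; unfold reverse_coercion; ring.

(** * Vectors and matrices *)

Section Sums.
Context {I : finType}.
Implicit Types F G : I -> R.

Lemma eq_vsum F G : (forall i, F i = G i) -> vsum F = vsum G.
Proof. by move=> e; apply: eq_bigr => i _. Qed.

Lemma vsumD F G : vsum (fun i => F i + G i) = vsum F + vsum G.
Proof. exact: big_split. Qed.

Lemma vsumZ c F : vsum (fun i => c * F i) = c * vsum F.
Proof.
symmetry; apply: (big_morph (Rmult c)); [exact: Rmult_plus_distr_l|exact: Rmult_0_r].
Qed.

Lemma vsum_ge0 F : (forall i, 0 <= F i) -> 0 <= vsum F.
Proof. by move=> h; rewrite /vsum; elim/big_ind: _ => //; [lra|move=> *; lra]. Qed.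

Lemma vsum_le F G : (forall i, F i <= G i) -> vsum F <= vsum G.
Proof. by move=> h; rewrite /vsum; elim/big_ind2: _ => //; [lra|move=> *; lra]. Qed.

Lemma vsum0 : vsum (fun _ : I => 0) = 0.
Proof. exact: big1. Qed.

Lemma vsum_ge_term F i : (forall i, 0 <= F i) -> F i <= vsum F.
Proof.
move=> h; rewrite /vsum (bigD1 i) //=.
set s := bigop _ _ _; suff: 0 <= s by lra.
by rewrite /s; elim/big_ind: _ => //; [lra|move=> *; lra].
Qed.
End Sums.

Lemma vsum_exchange {I J : finType} (F : I -> J -> R) :
  vsum (fun i => vsum (F i)) = vsum (fun j => vsum (fun i => F i j)).
Proof. exact: exchange_big. Qed.

Lemma vsum_prod {I J : finType} (F : I * J -> R) :
  vsum F = vsum (fun i => vsum (fun j => F (i, j))).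
Proof. rewrite /vsum pair_big /=; by apply: eq_bigr => -[i j]. Qed.

Lemma vsum_sum {I J : finType} (F : (I + J)%type -> R) :
  vsum F = vsum (fun i => F (inl i)) + vsum (fun j => F (inr j)).
Proof. by rewrite /vsum big_sumType. Qed.

Section Inner.
Context {I : finType}.
Implicit Types u v w : Vec I.

Lemma innerC u v : inner u v = inner v u.
Proof. by apply: eq_vsum => i; ring. Qed.
Lemma innerDl u v w : inner (vadd u v) w = inner u w + inner v w.
Proof. rewrite /inner -vsumD; by apply: eq_vsum => i; rewrite /vadd; ring. Qed.
Lemma innerDr u v w : inner w (vadd u v) = inner w u + inner w v.
Proof. by rewrite innerC innerDl !(innerC w). Qed.
Lemma innerZl c u v : inner (vscale c u) v = c * inner u v.
Proof. rewrite /inner -vsumZ; by apply: eq_vsum => i; rewrite /vscale; ring. Qed.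
Lemma innerZr c u v : inner u (vscale c v) = c * inner u v.
Proof. by rewrite innerC innerZl innerC. Qed.
Lemma vsubE u v : vsub u v = vadd u (vscale (-1) v).
Proof. vring. Qed.
Lemma voppE u : vopp u = vscale (-1) u.
Proof. vring. Qed.
Lemma innerBl u v w : inner (vsub u v) w = inner u w - inner v w.
Proof. rewrite vsubE innerDl innerZl; ring. Qed.
Lemma innerBr u v w : inner w (vsub u v) = inner w u - inner w v.
Proof. by rewrite innerC innerBl !(innerC w). Qed.
Lemma innerNl u v : inner (vopp u) v = - inner u v.
Proof. rewrite voppE innerZl; ring. Qed.
Lemma innerNr u v : inner u (vopp v) = - inner u v.
Proof. by rewrite innerC innerNl innerC. Qed.
Lemma inner0l v : inner vzero v = 0.
Proof. rewrite /inner -[RHS](@vsum0 I); by apply: eq_vsum => i; rewrite /vzero; ring. Qed.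
Lemma inner0r v : inner v vzero = 0.
Proof. by rewrite innerC inner0l. Qed.
Lemma inner_ge0 u : 0 <= inner u u.
Proof. apply: vsum_ge0 => i; nra. Qed.

Definition innerE := (innerDl, innerDr, innerBl, innerBr, innerNl, innerNr, innerZl, innerZr,
  inner0l, inner0r).

Lemma norm_ge0 u : 0 <= norm u. Proof. exact: sqrt_pos. Qed.
Lemma norm_sqr u : norm u * norm u = inner u u.
Proof. exact: sqrt_sqrt (inner_ge0 u). Qed.
Lemma norm_le_of_sqr u c : 0 <= c -> inner u u <= c * c -> norm u <= c.
Proof. move=> c0 h; have := norm_sqr u; have := norm_ge0 u; nra. Qed.

Lemma coord_le_norm u i : Rabs (u i) <= norm u.
Proof.
apply: Rabs_le; have := @vsum_ge_term _ (fun i => u i * u i) i (fun j => ltac:(nra)).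
rewrite -/(inner u u) -norm_sqr; have := norm_ge0 u; split; nra.
Qed.

Lemma norm_eq0 u : norm u <= 0 -> u = vzero.
Proof.
move=> h; apply: functional_extensionality => i; rewrite /vzero.
by have := coord_le_norm u i; split_Rabs; lra.
Qed.

Lemma Cauchy_Schwarz u v : inner u v <= norm u * norm v.
Proof.
case: (Rle_lt_dec (norm u) 0) => [/norm_eq0 e|u0].
  have -> : inner u v = 0 by rewrite e inner0l.
  have := norm_ge0 u; have := norm_ge0 v; nra.
case: (Rle_lt_dec (norm v) 0) => [/norm_eq0 e|v0].
  have -> : inner u v = 0 by rewrite e inner0r.
  have := norm_ge0 u; have := norm_ge0 v; nra.
have := inner_ge0 (vsub (vscale (norm v) u) (vscale (norm u) v)).
rewrite !innerE (innerC v u) -(norm_sqr u) -(norm_sqr v) => h.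
by apply: (Rmult_le_reg_l (2 * (norm u * norm v))); nra.
Qed.

Lemma Cauchy_Schwarz_abs u v : Rabs (inner u v) <= norm u * norm v.
Proof.
apply: Rabs_le; split; last exact: Cauchy_Schwarz.
have := Cauchy_Schwarz (vopp u) v; rewrite innerNl.
have -> : norm (vopp u) = norm u by rewrite /norm innerNl innerNr Ropp_involutive.
lra.
Qed.

Lemma norm_triangle u v : norm (vadd u v) <= norm u + norm v.
Proof.
have hu := norm_ge0 u; have hv := norm_ge0 v.
apply: norm_le_of_sqr; first lra.
rewrite !innerE (innerC v u) -!norm_sqr; have := Cauchy_Schwarz u v; nra.
Qed.

Lemma normZ c u : norm (vscale c u) = Rabs c * norm u.
Proof.
by rewrite /norm innerZl innerZr -Rmult_assoc sqrt_mult_alt ?sqrt_Rsqr_abs //; nra.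
Qed.

Lemma norm_subC u v : norm (vsub u v) = norm (vsub v u).
Proof.
have -> : vsub u v = vscale (-1) (vsub v u) by vring.
by rewrite normZ Rabs_Ropp Rabs_R1 Rmult_1_l.
Qed.

Lemma norm_sub_triangle u v w : norm (vsub u w) <= norm (vsub u v) + norm (vsub v w).
Proof. have -> : vsub u w = vadd (vsub u v) (vsub v w) by vring. exact: norm_triangle. Qed.

Lemma norm0 : norm (@vzero I) = 0.
Proof. by rewrite /norm inner0l sqrt_0. Qed.
End Inner.

Section Matrices.
Context {I J : finType}.
Implicit Types (M : Mat J I) (u v : Vec I) (w : Vec J).

Lemma mapplyD M u v : mapply M (vadd u v) = vadd (mapply M u) (mapply M v).
Proof.
apply: functional_extensionality => j; rewrite /mapply /vadd -vsumD.
by apply: eq_vsum => i; ring.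
Qed.
Lemma mapplyZ M c u : mapply M (vscale c u) = vscale c (mapply M u).
Proof.
apply: functional_extensionality => j; rewrite /mapply /vscale -vsumZ.
by apply: eq_vsum => i; ring.
Qed.
Lemma mapplyB M u v : mapply M (vsub u v) = vsub (mapply M u) (mapply M v).
Proof. by rewrite !vsubE mapplyD mapplyZ. Qed.
Lemma inner_tapply M u w : inner (tapply M w) u = inner w (mapply M u).
Proof.
rewrite /inner /tapply /mapply.
transitivity (vsum (fun i => vsum (fun j => M j i * w j * u i))).
  by apply: eq_vsum => i; rewrite Rmult_comm -vsumZ; apply: eq_vsum => j; ring.
rewrite vsum_exchange; apply: eq_vsum => j; rewrite -vsumZ.
by apply: eq_vsum => i; ring.
Qed.
Lemma tapplyD M w w' : tapply M (vadd w w') = vadd (tapply M w) (tapply M w').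
Proof.
apply: functional_extensionality => j; rewrite /tapply /vadd -vsumD.
by apply: eq_vsum => i; ring.
Qed.
Lemma tapplyZ M c w : tapply M (vscale c w) = vscale c (tapply M w).
Proof.
apply: functional_extensionality => j; rewrite /tapply /vscale -vsumZ.
by apply: eq_vsum => i; ring.
Qed.
Lemma tapplyB M w w' : tapply M (vsub w w') = vsub (tapply M w) (tapply M w').
Proof. by rewrite !vsubE tapplyD tapplyZ. Qed.

(** Cauchy-Schwarz row by row; the Frobenius norm [norm (mat2vec M)] serves as operator norm
    throughout. *)
Lemma norm_mapply M u : norm (mapply M u) <= norm (mat2vec M) * norm u.
Proof.
have hm := norm_ge0 (mat2vec M); have hu := norm_ge0 u.
apply: norm_le_of_sqr; first nra.
have -> : norm (mat2vec M) * norm u * (norm (mat2vec M) * norm u)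
  = norm u * norm u * (norm (mat2vec M) * norm (mat2vec M)) by ring.
rewrite (norm_sqr (mat2vec M)) /inner vsum_prod -vsumZ; apply: vsum_le => j.
have -> : mapply M u j = inner (M j) u by [].
have -> : vsum (fun i => mat2vec M (j, i) * mat2vec M (j, i)) = inner (M j) (M j) by [].
have := Cauchy_Schwarz_abs (M j) u; rewrite -(norm_sqr (M j)).
have := norm_ge0 (M j); have := Rabs_pos (inner (M j) u) => h1 h2 h3.
have -> : inner (M j) u * inner (M j) u = Rabs (inner (M j) u) * Rabs (inner (M j) u).
  by split_Rabs; ring.
have := Rmult_le_compat _ _ _ _ h1 h1 h3 h3; lra.
Qed.
End Matrices.

(** * Sequences and compactness *)

Definition eventually (P : nat -> Prop) := exists N, forall k, (N <= k)%N -> P k.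

Lemma eventually_and P Q : eventually P -> eventually Q -> eventually (fun k => P k /\ Q k).
Proof.
move=> [N h] [N' h']; exists (maxn N N') => k; rewrite geq_max => /andP [a b].
by split; [exact: h|exact: h'].
Qed.

Lemma eventually_mono (P Q : nat -> Prop) : (forall k, P k -> Q k) -> eventually P -> eventually Q.
Proof. by move=> h [N p]; exists N => k /p /h. Qed.

Lemma choice_seq {A : Type} (P : nat -> A -> Prop) :
  (forall k, exists a, P k a) -> exists f, forall k, P k (f k).
Proof.
move=> h; exists (fun k => proj1_sig (constructive_indefinite_description _ (h k))) => k.
by case: constructive_indefinite_description.
Qed.

Section RealSeq.
Implicit Types (u v : nat -> R) (a b : R).

Lemma cvP u a : Un_cv u a <-> forall eps, 0 < eps -> eventually (fun k => Rabs (u k - a) < eps).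
Proof.
split=> h eps /h [N hN]; exists N => k /leP ?; exact: hN.
Qed.

Lemma cv_const a : Un_cv (fun _ => a) a.
Proof. by apply/cvP => e e0; exists O => k _; rewrite Rminus_diag Rabs_R0. Qed.

Lemma cv_ext u v a : (forall k, u k = v k) -> Un_cv u a -> Un_cv v a.
Proof. by move=> e; have -> : v = u by apply: functional_extensionality. Qed.

Lemma cv_squeeze u v a : eventually (fun k => Rabs (u k - a) <= v k) -> Un_cv v 0 -> Un_cv u a.
Proof.
move=> ev /cvP cv; apply/cvP => e /cv cve.
apply: eventually_mono (eventually_and ev cve) => k [h1 h2].
move: h2; rewrite Rminus_0_r; split_Rabs; lra.
Qed.

Lemma cv_le u v a b : Un_cv u a -> Un_cv v b -> eventually (fun k => u k <= v k) -> a <= b.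
Proof.
move=> /cvP cu /cvP cv ev; case: (Rle_lt_dec a b) => // h.
have e0 : 0 < (a - b) / 2 by lra.
have [N hN] := eventually_and ev (eventually_and (cu _ e0) (cv _ e0)).
have [h1 [h2 h3]] := hN N (leqnn N).
by move: h2 h3; split_Rabs; lra.
Qed.

Lemma cvZ c u a : Un_cv u a -> Un_cv (fun k => c * u k) (c * a).
Proof. by move=> h; apply: CV_mult => //; exact: cv_const. Qed.

Lemma cv_subseq (phi : nat -> nat) u a :
  (forall k, (k <= phi k)%N) -> Un_cv u a -> Un_cv (fun k => u (phi k)) a.
Proof.
move=> hp /cvP cu; apply/cvP => e /cu [N hN]; exists N => k hk; apply: hN.
exact: leq_trans hk (hp k).
Qed.

Lemma cv_eventually_lt u a b : Un_cv u a -> a < b -> eventually (fun k => u k < b).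
Proof.
move=> /cvP cu h; apply: eventually_mono (cu (b - a) ltac:(lra)) => k.
by split_Rabs; lra.
Qed.

Lemma cv_sqrt u a : 0 <= a -> Un_cv u a -> Un_cv (fun k => sqrt (u k)) (sqrt a).
Proof. move=> a0; apply: continuity_seq; exact: continuity_pt_sqrt. Qed.

Definition small (k : nat) := / (INR k + 1).
Lemma small_gt0 k : 0 < small k.
Proof. apply: Rinv_0_lt_compat; have := pos_INR k; lra. Qed.
Lemma cv_small : Un_cv small 0.
Proof.
move=> e /RinvN_cv [N h]; exists N => k /h; by [].
Qed.
Lemma small_index (k j : nat) : small j < small k -> (k <= j)%N.
Proof.
rewrite /small => h; rewrite leqNgt; apply/negP => /ltP /lt_INR hl.
have := pos_INR j; have := pos_INR k => p q.
have : / (INR k + 1) <= / (INR j + 1) by apply: Rinv_le_contravar; lra.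
lra.
Qed.
Lemma eventually_small e : 0 < e -> eventually (fun k => small k < e).
Proof. by move=> e0; apply: cv_eventually_lt cv_small e0. Qed.
End RealSeq.

Lemma cv_vsum {I : finType} (F : nat -> I -> R) (f : I -> R) :
  (forall i, Un_cv (fun k => F k i) (f i)) -> Un_cv (fun k => vsum (F k)) (vsum f).
Proof.
move=> h; rewrite /vsum unlock; elim: (index_enum I) => [|i s ih] /=; first exact: cv_const.
by apply: CV_plus => //; exact: h.
Qed.

(** Convergence is taken coordinatewise so that sums, products, pairs and matrix images reduce to
    real sequences; [vcv_norm] gives the equivalence with convergence in norm. *)
Definition vcv {I : finType} (u : nat -> Vec I) (x : Vec I) :=
  forall i, Un_cv (fun k => u k i) (x i).

Section VecSeq.
Context {I : finType}.
Implicit Types (u v : nat -> Vec I) (x y : Vec I).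

Lemma vcv_const x : vcv (fun _ => x) x. Proof. move=> i; exact: cv_const. Qed.
Lemma vcv_ext u v x : (forall k, u k = v k) -> vcv u x -> vcv v x.
Proof. by move=> e; have -> : v = u by apply: functional_extensionality. Qed.
Lemma vcvD u v x y : vcv u x -> vcv v y -> vcv (fun k => vadd (u k) (v k)) (vadd x y).
Proof. move=> h h' i; exact: CV_plus. Qed.
Lemma vcvB u v x y : vcv u x -> vcv v y -> vcv (fun k => vsub (u k) (v k)) (vsub x y).
Proof. move=> h h' i; exact: CV_minus. Qed.
Lemma vcvZ c a u x : Un_cv c a -> vcv u x -> vcv (fun k => vscale (c k) (u k)) (vscale a x).
Proof. move=> h h' i; exact: CV_mult. Qed.
Lemma vcv_null (c : nat -> R) u x : Un_cv c 0 -> vcv u x -> vcv (fun k => vscale (c k) (u k)) vzero.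
Proof. by move=> h h'; have := vcvZ h h'; have -> : vscale 0 x = vzero by vring. Qed.
Lemma cv_inner u v x y : vcv u x -> vcv v y -> Un_cv (fun k => inner (u k) (v k)) (inner x y).
Proof. move=> h h'; apply: cv_vsum => i; exact: CV_mult. Qed.
Lemma cv_norm u x : vcv u x -> Un_cv (fun k => norm (u k)) (norm x).
Proof. by move=> h; apply: cv_sqrt; [exact: inner_ge0|exact: cv_inner]. Qed.
Lemma vcv_norm u x : Un_cv (fun k => norm (vsub (u k) x)) 0 <-> vcv u x.
Proof.
split=> h; last first.
  have := cv_norm (vcvB h (vcv_const x)).
  by have -> : vsub x x = vzero; [vring|rewrite norm0].
move=> i; apply: cv_squeeze h; exists O => k _; exact: (coord_le_norm (vsub (u k) x)).
Qed.
Lemma vcv_squeeze u x v : eventually (fun k => norm (vsub (u k) x) <= norm (v k)) ->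
  vcv v vzero -> vcv u x.
Proof.
move=> h /cv_norm; rewrite norm0 => hv; apply/vcv_norm; apply: cv_squeeze hv.
apply: eventually_mono h => k; rewrite Rminus_0_r Rabs_pos_eq //; exact: norm_ge0.
Qed.
Lemma vcv_squeezeR u x (e : nat -> R) : eventually (fun k => norm (vsub (u k) x) <= e k) ->
  Un_cv e 0 -> vcv u x.
Proof.
move=> h he; apply/vcv_norm; apply: cv_squeeze he.
apply: eventually_mono h => k; rewrite Rminus_0_r Rabs_pos_eq //; exact: norm_ge0.
Qed.
Lemma vcv_unique u x y : vcv u x -> vcv u y -> x = y.
Proof. move=> h h'; apply: functional_extensionality => i; exact: UL_sequence (h i) (h' i). Qed.
Lemma vcv_subseq (phi : nat -> nat) u x :
  (forall k, (k <= phi k)%N) -> vcv u x -> vcv (fun k => u (phi k)) x.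
Proof. move=> hp h i; exact: (cv_subseq hp (h i)). Qed.
Lemma vcv_eventually u x e : vcv u x -> 0 < e -> eventually (fun k => norm (vsub (u k) x) < e).
Proof. by move=> /vcv_norm h; exact: cv_eventually_lt. Qed.
Lemma closed_vcv (S : Vec I -> Prop) u x :
  is_closed S -> vcv u x -> eventually (fun k => S (u k)) -> S x.
Proof.
move=> cl cu ev; apply: cl => e e0.
have [N h] := eventually_and ev (vcv_eventually cu e0).
by exists (u N); exact: h.
Qed.
End VecSeq.

Lemma vcv_mapply {I J : finType} (M : nat -> Mat J I) (N : Mat J I) u x :
  (forall j i, Un_cv (fun k => M k j i) (N j i)) -> vcv u x ->
  vcv (fun k => mapply (M k) (u k)) (mapply N x).
Proof. move=> hM hu j; apply: cv_vsum => i; exact: CV_mult. Qed.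
Lemma vcv_mapplyc {I J : finType} (M : Mat J I) u x :
  vcv u x -> vcv (fun k => mapply M (u k)) (mapply M x).
Proof. move=> h; apply: (vcv_mapply (M := fun _ => M)) => // *; exact: cv_const. Qed.
Lemma vcv_tapply {I J : finType} (M : nat -> Mat J I) (N : Mat J I) u x :
  (forall j i, Un_cv (fun k => M k j i) (N j i)) -> vcv u x ->
  vcv (fun k => tapply (M k) (u k)) (tapply N x).
Proof. move=> hM hu j; apply: cv_vsum => i; exact: CV_mult. Qed.
Lemma vcv_tapplyc {I J : finType} (M : Mat J I) u x :
  vcv u x -> vcv (fun k => tapply M (u k)) (tapply M x).
Proof. move=> h; apply: (vcv_tapply (M := fun _ => M)) => // *; exact: cv_const. Qed.

Section Pairs.
Context {I J : finType}.

Lemma inner_vpair (a a' : Vec I) (b b' : Vec J) :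
  inner (vpair a b) (vpair a' b') = inner a a' + inner b b'.
Proof. exact: vsum_sum. Qed.
Lemma vpair_eta (w : Vec (I + J)%type) : w = vpair (vfst w) (vsnd w).
Proof. by apply: functional_extensionality => -[]. Qed.
Lemma vpairD (a a' : Vec I) (b b' : Vec J) :
  vadd (vpair a b) (vpair a' b') = vpair (vadd a a') (vadd b b').
Proof. by apply: functional_extensionality => -[]. Qed.
Lemma vpairB (a a' : Vec I) (b b' : Vec J) :
  vsub (vpair a b) (vpair a' b') = vpair (vsub a a') (vsub b b').
Proof. by apply: functional_extensionality => -[]. Qed.
Lemma vpairZ c (a : Vec I) (b : Vec J) : vscale c (vpair a b) = vpair (vscale c a) (vscale c b).
Proof. by apply: functional_extensionality => -[]. Qed.
Lemma norm_vpair (a : Vec I) (b : Vec J) :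
  norm (vpair a b) * norm (vpair a b) = norm a * norm a + norm b * norm b.
Proof. by rewrite !norm_sqr inner_vpair. Qed.
Lemma norm_vpair_le (a : Vec I) (b : Vec J) : norm (vpair a b) <= norm a + norm b.
Proof.
have := norm_vpair a b; have := norm_ge0 a; have := norm_ge0 b; have := norm_ge0 (vpair a b); nra.
Qed.
Lemma norm_vpair_l (a : Vec I) (b : Vec J) : norm a <= norm (vpair a b).
Proof.
have := norm_vpair a b; have := norm_ge0 a; have := norm_ge0 b; have := norm_ge0 (vpair a b); nra.
Qed.
Lemma norm_vpair_r (a : Vec I) (b : Vec J) : norm b <= norm (vpair a b).
Proof.
have := norm_vpair a b; have := norm_ge0 a; have := norm_ge0 b; have := norm_ge0 (vpair a b); nra.
Qed.
Lemma norm_vpair0 (b : Vec J) : norm (vpair (@vzero I) b) = norm b.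
Proof.
have := norm_vpair (@vzero I) b; rewrite norm0.
have := norm_ge0 b; have := norm_ge0 (vpair (@vzero I) b); nra.
Qed.
Lemma vcv_vpair (u : nat -> Vec I) (v : nat -> Vec J) a b :
  vcv u a -> vcv v b -> vcv (fun k => vpair (u k) (v k)) (vpair a b).
Proof. by move=> hu hv [i|j] /=; [exact: hu|exact: hv]. Qed.
End Pairs.

(** [r] is the lower limit of [f] along the conditions [Q e], obtained as the supremum of the
    eventual lower bounds. A monotone family of conditions replaces subsequences so that
    [cluster_vec] can strengthen [Q] one coordinate at a time. *)
Lemma cluster_real {A : Type} (Q : R -> A -> Prop) (f : A -> R) B :
  (forall e e' a, e <= e' -> Q e a -> Q e' a) ->
  (forall e, 0 < e -> exists a, Q e a /\ Rabs (f a) <= B) ->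
  exists r, forall e, 0 < e -> exists a, [/\ Q e a, Rabs (f a) <= B & Rabs (f a - r) < e].
Proof.
move=> Q_mono h.
pose S s := exists2 e, 0 < e & forall a, Q e a -> Rabs (f a) <= B -> s <= f a.
have bS : bound S.
  exists B => s [e e0 hs]; have [a [qa ha]] := h e e0.
  by have := hs a qa ha; move: ha; split_Rabs; lra.
have nS : exists s, S s by exists (- B); exists 1; [lra|move=> a _; split_Rabs; lra].
have [r [ub lub]] := completeness S bS nS.
exists r => e e0.
have [s [[e1 e10 hs] rs]] : exists s, S s /\ r - e < s.
  apply: NNPP => nex; have : is_upper_bound S (r - e).
    by move=> s Ss; case: (Rle_lt_dec s (r - e)) => // hlt; case: nex; exists s.
  by move/lub; lra.
have m0 : 0 < Rmin e e1 by apply: Rmin_glb_lt.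
have [a [qa [ha hlt]]] : exists a, Q (Rmin e e1) a /\ Rabs (f a) <= B /\ f a < r + e / 2.
  apply: NNPP => nex; have : S (r + e / 2).
    exists (Rmin e e1) => // a qa ha; case: (Rle_lt_dec (r + e / 2) (f a)) => // hlt.
    by case: nex; exists a.
  by move/ub; lra.
exists a; split=> //; first by apply: Q_mono qa; exact: Rmin_l.
have := hs a (Q_mono _ _ _ (Rmin_r e e1) qa) ha; split_Rabs; lra.
Qed.
(** Induction over the coordinates: closeness in those already treated is absorbed into the
    condition [Q'], and [cluster_real] handles the next one. *)
Lemma cluster_vec {A : Type} {I : finType} (Q : R -> A -> Prop) (f : A -> Vec I) B :
  (forall e e' a, e <= e' -> Q e a -> Q e' a) ->
  (forall e, 0 < e -> exists a, Q e a /\ norm (f a) <= B) ->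
  exists x : Vec I, forall e, 0 < e -> exists a, Q e a /\ forall i, Rabs (f a i - x i) < e.
Proof.
move=> Qm h.
suff [x hx] : exists x : Vec I, forall e, 0 < e ->
    exists a, [/\ Q e a, norm (f a) <= B & forall i, i \in enum I -> Rabs (f a i - x i) < e].
  by exists x => e /hx [a [qa _ ha]]; exists a; split=> // i; apply: ha; rewrite mem_enum.
elim: (enum I) => [|i s [x hx]].
  by exists vzero => e /h [a [qa ha]]; exists a; split.
pose Q' e a := [/\ Q e a, norm (f a) <= B & forall i, i \in s -> Rabs (f a i - x i) < e].
have Qm' : forall e e' a, e <= e' -> Q' e a -> Q' e' a.
  move=> e e' a ee [q1 q2 q3]; split=> //; first exact: Qm q1.
  by move=> j /q3; lra.
have [|r hr] := @cluster_real _ Q' (fun a => f a i) B Qm'.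
  move=> e /hx [a qa]; exists a; split=> //.
  by have [_ q _] := qa; have := coord_le_norm (f a) i; lra.
exists (fun j => if j == i then r else x j) => e /hr [a [[q1 q2 q3] _ q5]].
exists a; split=> // j; rewrite inE; case: eqP => [->|_ /=] //; exact: q3.
Qed.

(** Here the condition [Q e] says that the index is large. The map [phi] need not be increasing:
    [k <= phi k] suffices to carry limits over. *)
Lemma BW_seq {I : finType} (u : nat -> Vec I) B : (forall k, norm (u k) <= B) ->
  exists (x : Vec I) phi, (forall k, (k <= phi k)%N) /\ vcv (fun k => u (phi k)) x.
Proof.
move=> h.
have [|e /eventually_small [N hN]|x hx] := @cluster_vec _ _ (fun e k => small k < e) u B.
- by move=> e e' k; lra.
- by exists N; split=> //; exact: hN.
have [phi hphi] : exists phi : nat -> nat, forall k, small (phi k) < small k /\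
    forall i, Rabs (u (phi k) i - x i) < small k.
  apply: (@choice_seq nat (fun k j => small j < small k /\ forall i, Rabs (u j i - x i) < small k)) => k.
  exact: hx (small_gt0 k).
exists x, phi; split=> [k|i]; first by apply: small_index; case: (hphi k).
apply: cv_squeeze cv_small; exists O => k _; have := (hphi k).2 i; lra.
Qed.

Lemma nearest_point {I : finType} (S : Vec I -> Prop) x :
  is_closed S -> (exists y, S y) ->
  exists y, S y /\ forall z, S z -> norm (vsub x y) <= norm (vsub x z).
Proof.
move=> cl [y0 Sy0].
(* Distances are negated because [completeness] yields suprema; [- r] is the distance from [x] to
   [S]. *)
pose D r := exists2 z, S z & r = - norm (vsub x z).
have [r [ub lub]] : {r | is_lub D r}.
  apply: completeness; last by exists (- norm (vsub x y0)), y0.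
  by exists 0 => r [z _ ->]; have := norm_ge0 (vsub x z); lra.
have [u hu] : exists u : nat -> Vec I, forall k, S (u k) /\ norm (vsub x (u k)) < - r + small k.
  apply: (@choice_seq (Vec I) (fun k a => S a /\ norm (vsub x a) < - r + small k)) => k.
  apply: NNPP => nex; have : is_upper_bound D (r - small k).
    move=> s [z Sz ->]; case: (Rle_lt_dec (- norm (vsub x z)) (r - small k)) => // hlt.
    by case: nex; exists z; split=> //; lra.
  by move/lub; have := small_gt0 k; lra.
have small1 k : small k <= 1.
  rewrite /small -[X in _ <= X]Rinv_1; apply: Rinv_le_contravar; first lra.
  by have := pos_INR k; lra.
have [k|y [phi [hp cu]]] := @BW_seq _ (fun k => vsub (u k) x) (- r + 1).
  by rewrite norm_subC; have [_] := hu k; have := small1 k; lra.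
have cy : vcv (fun k => u (phi k)) (vadd x y).
  apply: vcv_ext (vcvD (vcv_const x) cu) => k; vring.
exists (vadd x y); split.
  by apply: closed_vcv cl cy _; exists O => k _; case: (hu (phi k)).
move=> z Sz; have h : - norm (vsub x z) <= r by apply: ub; exists z.
apply: (@Rle_trans _ (- r)); last lra.
apply: (cv_le (cv_norm (vcvB (vcv_const x) cy)) (v := fun k => - r + small (phi k))).
  by have := CV_plus _ _ _ _ (cv_const (- r)) (cv_subseq hp cv_small); rewrite Rplus_0_r.
by exists O => k _; have [_] := hu (phi k); lra.
Qed.

(* Differences need only be bounded along the sequence, not convergent. *)
Lemma fderiv_seq {I J : finType} (f : Vec I -> Vec J) x M (t : nat -> R) (v : nat -> Vec I) B :
  fderiv f x M -> (forall k, 0 < t k) -> Un_cv t 0 -> (forall k, norm (v k) <= B) ->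
  vcv (fun k => vsub (vscale (/ t k) (vsub (f (vadd x (vscale (t k) (v k)))) (f x)))
                     (mapply M (v k))) vzero.
Proof.
move=> df t0 ct bv.
apply/vcv_norm/cvP => e e0.
have B0 : 0 <= B by have := norm_ge0 (v O); have := bv O; lra.
have e1 : 0 < e / (B + 1) by apply: Rdiv_lt_0_compat; lra.
have [de [de0 hde]] := df _ e1.
have ev : eventually (fun k => t k * (B + 1) < de).
  apply: (cv_eventually_lt (a := 0 * (B + 1))); last lra.
  by apply: CV_mult => //; exact: cv_const.
apply: eventually_mono ev => k hk.
have tk := t0 k; have bk := bv k; have nk := norm_ge0 (v k).
have E : vsub (vadd x (vscale (t k) (v k))) x = vscale (t k) (v k) by vring.
have nE : norm (vscale (t k) (v k)) = t k * norm (v k) by rewrite normZ Rabs_pos_eq; lra.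
have := hde (vadd x (vscale (t k) (v k))); rewrite E nE => /(_ ltac:(nra)).
rewrite mapplyZ Rminus_0_r Rabs_pos_eq; last exact: norm_ge0.
set d := vsub (f _) (f x) => h.
have -> : vsub (vsub (vscale (/ t k) d) (mapply M (v k))) vzero =
   vscale (/ t k) (vsub d (vscale (t k) (mapply M (v k)))).
  apply: functional_extensionality => i; rewrite /vsub /vscale /vzero; field; lra.
rewrite normZ Rabs_pos_eq; last by apply: Rlt_le; apply: Rinv_0_lt_compat.
apply: (Rmult_lt_reg_l (t k)) => //.
rewrite -Rmult_assoc Rinv_r ?Rmult_1_l; last lra.
apply: (Rle_lt_trans _ _ _ h).
have ee : e = e / (B + 1) * (B + 1) by field; lra.
move: e1 ee; set c := e / (B + 1) => e1 ->.
have := Rmult_lt_0_compat _ _ e1 tk; nra.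
Qed.

(** * Convex cones and multipliers *)

(** Stands in for letting [s] tend to 0; the bound [s <= 1] keeps [s] usable as a weight in convex
    combinations. *)
Lemma le0_of_small_mul a b : (forall s, 0 < s <= 1 -> a <= s * b) -> a <= 0.
Proof.
move=> h; case: (Rle_lt_dec a 0) => // a0.
have b0 : a <= b by have := h 1; lra.
have p : 0 < a / (2 * b) by apply: Rdiv_lt_0_compat; lra.
have e : a / (2 * b) * b = a / 2 by field; lra.
have := h (a / (2 * b)); nra.
Qed.

Lemma is_closed_ball {I : finType} (c : Vec I) r : is_closed (fun x => norm (vsub x c) <= r).
Proof.
move=> x h; case: (Rle_lt_dec (norm (vsub x c)) r) => // hr.
have [y [hy hyx]] := h (norm (vsub x c) - r) ltac:(lra).
by have := norm_sub_triangle x y c; rewrite (norm_subC x y); lra.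
Qed.

Lemma convex_projection {I : finType} (D : Vec I -> Prop) x :
  is_closed D -> is_convex D -> (exists y, D y) ->
  exists y, D y /\ forall z, D z -> inner (vsub x y) (vsub z y) <= 0.
Proof.
move=> cl cv ne; have [y [Dy hy]] := nearest_point x cl ne.
exists y; split=> // z Dz.
suff: 2 * inner (vsub x y) (vsub z y) <= 0 by lra.
apply: (@le0_of_small_mul _ (inner (vsub z y) (vsub z y))) => s s01.
have := hy _ (cv z y s Dz Dy ltac:(lra)).
have -> : vsub x (vadd (vscale s z) (vscale (1 - s) y)) = vsub (vsub x y) (vscale s (vsub z y)).
  vring.
move: (vsub x y) (vsub z y) => p q h.
have h2 : inner p p <= inner (vsub p (vscale s q)) (vsub p (vscale s q)).
  rewrite -!norm_sqr; have := norm_ge0 p; nra.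
rewrite !innerE (innerC q p) in h2; nra.
Qed.

Section Cones.
Context {I : finType}.
Implicit Types (K : Vec I -> Prop).

Lemma cone_add K a b : is_convex K -> is_cone K -> K a -> K b -> K (vadd a b).
Proof.
move=> cv [_ sc] ka kb; have := cv a b (1/2) ka kb ltac:(lra).
move=> /(sc _ 2) /(_ ltac:(lra)).
by have -> : vscale 2 (vadd (vscale (1 / 2) a) (vscale (1 - 1 / 2) b)) = vadd a b
  by apply: functional_extensionality => i; rewrite /vscale /vadd; field.
Qed.

Lemma lin_cone_sub K a b : is_convex K -> is_cone K -> K (vadd a b) -> lin K a -> K b.
Proof.
move=> cv cn kab [_ kna]; have := cone_add cv cn kab kna.
by have -> : vadd (vadd a b) (vopp a) = b by vring.
Qed.

Lemma lin_scale K a s : is_cone K -> lin K a -> 0 <= s -> lin K (vscale s a).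
Proof.
move=> [_ sc] [ka kna] s0; split; first exact: sc.
have -> : vopp (vscale s a) = vscale s (vopp a) by vring.
exact: sc.
Qed.

Lemma lin_add K a b : is_convex K -> is_cone K -> lin K a -> lin K b -> lin K (vadd a b).
Proof.
move=> cv cn [ka kna] [kb knb]; split; first exact: cone_add.
have -> : vopp (vadd a b) = vadd (vopp a) (vopp b) by vring.
exact: cone_add.
Qed.

Lemma polar_lin K mu a : polar K mu -> lin K a -> inner mu a = 0.
Proof. by move=> hm [/hm h1 /hm]; rewrite innerNr; lra. Qed.

Lemma polar_add K mu nu : polar K mu -> polar K nu -> polar K (vadd mu nu).
Proof. by move=> h h' a ka; rewrite innerDl; have := h a ka; have := h' a ka; lra. Qed.

Lemma polar_scale K mu s : 0 <= s -> polar K mu -> polar K (vscale s mu).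
Proof. by move=> s0 h a ka; rewrite innerZl; have := h a ka; nra. Qed.

(** Moreau decomposition: the multiples [2 y] and [0] of the projection stay in the cone, and
    testing with both makes the residual orthogonal to [y]. *)
Lemma cone_projection K x : is_closed K -> is_convex K -> is_cone K ->
  exists y, [/\ K y, polar K (vsub x y) & inner (vsub x y) y = 0].
Proof.
move=> cl cv cn; have [|y [ky hy]] := convex_projection x cl cv.
  by exists vzero; case: cn.
have e0 : inner (vsub x y) y = 0.
  have [_ sc] := cn.
  have := hy _ (sc _ 2 ky ltac:(lra)); have := hy _ (sc _ 0 ky ltac:(lra)).
  rewrite !(innerBr, innerZr); lra.
exists y; split=> // z kz; have := hy _ kz; rewrite innerBr e0; lra.
Qed.

(** The residual of the projection of [a] lies in the polar cone, so it pairs nonpositively with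
    [a]; by orthogonality to the projection this pairing is its squared norm. *)
Lemma bipolar K a : is_closed K -> is_convex K -> is_cone K -> polar (polar K) a -> K a.
Proof.
move=> cl cv cn h; have [y [ky py e0]] := cone_projection a cl cv cn.
have := h _ py; rewrite (innerC a) => h2.
have h3 : inner (vsub a y) (vsub a y) <= 0 by rewrite innerBr e0; lra.
have : vsub a y = vzero.
  apply: norm_eq0; apply: norm_le_of_sqr; lra.
move=> e; suff -> : a = y by [].
apply: functional_extensionality => i; have := congr1 (fun f => f i) e.
rewrite /vsub /vzero; lra.
Qed.

Lemma closed_polar K : is_closed (polar K).
Proof.
move=> mu h a ka.
suff: forall e, 0 < e <= 1 -> inner mu a <= e * norm a by exact: le0_of_small_mul.
move=> e e0; have [nu [hn hd]] := h e ltac:(lra).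
have := hn a ka; have := Cauchy_Schwarz (vsub mu nu) a; rewrite innerBl norm_subC.
have := norm_ge0 a; nra.
Qed.

(* The affine combination [(1+s) mu - s nu] leaves [mu] away from [nu], so it remains in the polar
   cone for small [s]. *)
Lemma ri_polar_extend K mu nu : rel_interior (polar K) mu -> polar K nu ->
  exists s, 0 < s /\ polar K (vsub (vscale (1 + s) mu) (vscale s nu)).
Proof.
move=> [pm [e [e0 he]]] pn.
have n0 := norm_ge0 (vsub mu nu).
have h0 : 0 < e / (2 * (norm (vsub mu nu) + 1)) by apply: Rdiv_lt_0_compat; lra.
exists (e / (2 * (norm (vsub mu nu) + 1))); split=> //.
set s := e / _ in h0 *; apply: he.
  exists [:: (1 + s, mu); (- s, nu)]; split.
    by constructor=> //; constructor=> //; apply: List.Forall_nil.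
  split=> [|i] /=; first ring.
  rewrite /vsub /vscale; ring.
have -> : vsub (vsub (vscale (1 + s) mu) (vscale s nu)) mu = vscale s (vsub mu nu) by vring.
rewrite normZ Rabs_pos_eq; last lra.
have : s * (2 * (norm (vsub mu nu) + 1)) = e by rewrite /s; field; lra.
nra.
Qed.

(** For [nu] in the polar cone, pairing [(1+s) mu - s nu] with [a] gives [<nu, a> >= 0]; hence [- a]
    lies in the bipolar. This is how strict complementarity is turned into membership in [lin K]. *)
Lemma ri_polar_lin K mu a : is_closed K -> is_convex K -> is_cone K ->
  rel_interior (polar K) mu -> K a -> inner mu a = 0 -> lin K a.
Proof.
move=> cl cv cn ri ka e0; split=> //; apply: bipolar => // nu pn.
have [s [s0 /(_ a ka)]] := ri_polar_extend ri pn.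
rewrite innerNl (innerC a) !(innerBl, innerZl) e0; nra.
Qed.
End Cones.

Definition is_subspace {I : finType} (W : Vec I -> Prop) :=
  [/\ W vzero, forall a b, W a -> W b -> W (vadd a b) & forall c a, W a -> W (vscale c a)].

(* Induction on the coordinates on which [W] does not vanish: a vector [w0] of [W] with [w0 i = 1]
   allows to eliminate coordinate [i]. *)
Lemma closed_subspace {I : finType} (W : Vec I -> Prop) : is_subspace W -> is_closed W.
Proof.
suff H (s : seq I) : forall W : Vec I -> Prop, is_subspace W ->
    (forall w i, W w -> i \notin s -> w i = 0) -> is_closed W.
  by move=> sW; apply: (H (enum I)) => // w i _; rewrite mem_enum.
elim: s => [|i s ih] {}W [W0 WD WZ] van x hx.
  suff -> : x = vzero by [].
  apply: norm_eq0; case: (Rle_lt_dec (norm x) 0) => // /hx [y [Wy]].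
  have -> : y = vzero by apply: functional_extensionality => i; exact: van.
  by rewrite norm_subC; have -> : vsub x vzero = x; [vring|lra].
case: (classic (exists w, W w /\ w i <> 0)) => [[w1 [Ww1 n0]]|nex]; last first.
  apply: (ih W) => // w j Ww; case: (eqVneq j i) => [->|ji] js.
    by apply: NNPP => n0; apply: nex; exists w.
  by apply: van => //; rewrite inE negb_or ji.
pose w0 := vscale (/ w1 i) w1.
have Ww0 : W w0 by exact: WZ.
have e1 : w0 i = 1 by rewrite /w0 /vscale; field.
have sW' : is_subspace (fun w => W w /\ w i = 0).
  split=> [//|a b [Wa a0] [Wb b0]|c a [Wa a0]].
    by split; [exact: WD|rewrite /vadd a0 b0; ring].
  by split; [exact: WZ|rewrite /vscale a0; ring].
have cW' : is_closed (fun w => W w /\ w i = 0).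
  apply: ih => // w j [Ww wi] js; case: (eqVneq j i) => [->//|ji].
  by apply: van => //; rewrite inE negb_or ji.
have [h _] : W (vsub x (vscale (x i) w0)) /\ vsub x (vscale (x i) w0) i = 0.
  apply: cW' => e e0.
  have nw := norm_ge0 w0.
  have e2 : 0 < e / (1 + norm w0) by apply: Rdiv_lt_0_compat; lra.
  have [y [Wy hy]] := hx _ e2.
  exists (vsub y (vscale (y i) w0)); split.
    split; last by rewrite /vsub /vscale e1; ring.
    by rewrite vsubE; apply: WD => //; exact/WZ/WZ.
  have -> : vsub (vsub y (vscale (y i) w0)) (vsub x (vscale (x i) w0)) =
    vadd (vsub y x) (vscale (- (vsub y x i)) w0) by vring.
  apply: (Rle_lt_trans _ _ _ (norm_triangle _ _)); rewrite normZ Rabs_Ropp.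
  have := coord_le_norm (vsub y x) i.
  have : e / (1 + norm w0) * (1 + norm w0) = e by field; lra.
  nra.
have -> : x = vadd (vsub x (vscale (x i) w0)) (vscale (x i) w0) by vring.
by apply: WD => //; exact: WZ.
Qed.

Lemma subspace_tapply {I J : finType} (M : Mat J I) (W : Vec J -> Prop) :
  is_subspace W -> is_subspace (fun y => exists2 w, W w & y = tapply M w).
Proof.
move=> [W0 WD WZ]; split.
- exists vzero => //; apply: functional_extensionality => i.
  rewrite /tapply -[LHS](@vsum0 J); apply: eq_vsum => j; rewrite /vzero; ring.
- by move=> _ _ [a Wa ->] [b Wb ->]; exists (vadd a b); [exact: WD|rewrite tapplyD].
- by move=> c _ [a Wa ->]; exists (vscale c a); [exact: WZ|rewrite tapplyZ].
Qed.

(** Sums and nonnegative multiples are clear; the relative interior supplies negatives, since [- nu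
    = ((1+s) mu - s nu)/s - ((1+s)/s) mu]. *)
Lemma ri_polar_subspace {I : finType} (K : Vec I -> Prop) mu :
  is_cone K -> rel_interior (polar K) mu ->
  is_subspace (fun w => exists nu c, polar K nu /\ 0 <= c /\ w = vsub nu (vscale c mu)).
Proof.
move=> cn ri.
have p0 : polar K vzero by move=> a _; rewrite inner0l; lra.
have pm : polar K mu by case: ri.
split.
- by exists vzero, 0; split=> //; split; [lra|vring].
- move=> _ _ [nu [c [pn [c0 ->]]]] [nu' [c' [pn' [c0' ->]]]].
  exists (vadd nu nu'), (c + c'); split; first exact: polar_add.
  by split; [lra|vring].
- move=> c _ [nu [c' [pn [c0' ->]]]].
  case: (Rle_lt_dec 0 c) => hc.
    exists (vscale c nu), (c * c'); split; first exact: polar_scale.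
    by split; [nra|vring].
  have [s [s0 ps]] := ri_polar_extend ri pn.
  exists (vadd (vscale (- c / s) (vsub (vscale (1 + s) mu) (vscale s nu))) (vscale (- c * c') mu)).
  exists (- c / s * (1 + s)); split.
    apply: polar_add; apply: polar_scale => //; first by apply: Rlt_le; apply: Rdiv_lt_0_compat; lra.
    nra.
  split; first by apply: Rmult_le_pos; [apply: Rlt_le; apply: Rdiv_lt_0_compat; lra|lra].
  apply: functional_extensionality => i; rewrite /vadd /vsub /vscale; field; lra.
Qed.

(** Lets [bounded_multiplier] project onto the closure of its cone, which is not assumed closed. *)
Lemma closure_inequality {J : finType} (T : Vec J -> Prop) b c r :
  0 <= r -> (forall tau, T tau -> c <= r * norm (vsub b tau)) ->
  forall tau, (forall e, 0 < e -> exists y, T y /\ norm (vsub y tau) < e) ->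
  c <= r * norm (vsub b tau).
Proof.
move=> r0 h tau ht.
suff: c - r * norm (vsub b tau) <= 0 by lra.
apply: (@le0_of_small_mul _ r) => s s0; have [y [Ty hy]] := ht s ltac:(lra).
have := h y Ty; have := norm_sub_triangle b tau y; rewrite (norm_subC tau y); nra.
Qed.

(* Dual form of the distance estimate: otherwise [xs] is separated from the compact convex set
   [{M^T mu | mu in T^*, |mu| <= r}], while [dist (b, T) = sup {<mu, b> | mu in T^*, |mu| <= 1}]. *)
Lemma bounded_multiplier {I J : finType} (M : Mat J I) (T : Vec J -> Prop) (xs : Vec I) r :
  0 <= r -> is_convex T -> is_cone T ->
  (forall u tau, T tau -> inner xs u <= r * norm (vsub (mapply M u) tau)) ->
  exists mu, [/\ polar T mu, norm mu <= r & tapply M mu = xs].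
Proof.
move=> r0 cvT cnT h.
pose D y := exists mu, [/\ polar T mu, norm mu <= r & y = tapply M mu].
have p0 : polar T vzero by move=> a _; rewrite inner0l; lra.
have clD : is_closed D.
  move=> y hy.
  have [mu hmu] := choice_seq (P := fun k mu => (polar T mu /\ norm mu <= r) /\
      norm (vsub (tapply M mu) y) < small k)
    ltac:(move=> k; have [_ [[mu [h1 h2 ->]] h3]] := hy _ (small_gt0 k); by exists mu).
  have [k|mu0 [phi [hp cm]]] := @BW_seq _ mu r; first by case: (hmu k) => -[].
  exists mu0; split.
  - by apply: closed_vcv (@closed_polar _ T) cm _; exists O => k _; case: (hmu (phi k)) => -[].
  - by apply: cv_le (cv_norm cm) (cv_const r) _; exists O => k _; case: (hmu (phi k)) => -[].
  - apply: vcv_unique (vcv_tapplyc M cm).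
    apply: vcv_squeezeR (cv_subseq hp cv_small); exists O => k _; case: (hmu (phi k)) => _; lra.
have cvD : is_convex D.
  move=> _ _ s [mu [p1 n1 ->]] [nu [p2 n2 ->]] s01.
  exists (vadd (vscale s mu) (vscale (1 - s) nu)); split.
  - by apply: polar_add; apply: polar_scale => //; lra.
  - apply: (Rle_trans _ _ _ (norm_triangle _ _)); rewrite !normZ !Rabs_pos_eq; nra.
  - by rewrite tapplyD !tapplyZ.
have [|_ [[mu0 [pm nm ->]] hy]] := convex_projection xs clD cvD.
  by exists (tapply M vzero), vzero; split=> //; rewrite norm0.
exists mu0; split=> //.
set u := vsub xs (tapply M mu0) in hy.
suff u0 : u = vzero.
  apply: functional_extensionality => i; have := congr1 (fun f => f i) u0.
  rewrite /u /vsub /vzero; lra.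
pose clT y := forall e, 0 < e -> exists z, T z /\ norm (vsub z y) < e.
have cclT : is_closed clT.
  move=> y hy' e e0; have [z [hz hzy]] := hy' (e/2) ltac:(lra).
  have [z' [Tz' hz']] := hz (e/2) ltac:(lra); exists z'; split=> //.
  have := norm_sub_triangle z' z y; lra.
have cvclT : is_convex clT.
  move=> a b s ha hb s01 e e0.
  have [a' [Ta ha']] := ha e e0; have [b' [Tb hb']] := hb e e0.
  exists (vadd (vscale s a') (vscale (1 - s) b')); split; first exact: cvT.
  have -> : vsub (vadd (vscale s a') (vscale (1 - s) b')) (vadd (vscale s a) (vscale (1 - s) b)) =
    vadd (vscale s (vsub a' a)) (vscale (1 - s) (vsub b' b)) by vring.
  apply: (Rle_lt_trans _ _ _ (norm_triangle _ _)); rewrite !normZ !Rabs_pos_eq; try lra.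
  have h1 : s * norm (vsub a' a) <= s * e by apply: Rmult_le_compat_l; lra.
  have h2 : (1 - s) * norm (vsub b' b) <= (1 - s) * e by apply: Rmult_le_compat_l; lra.
  case: (Rle_lt_dec s (1/2)) => hs.
    have : (1 - s) * norm (vsub b' b) < (1 - s) * e by apply: Rmult_lt_compat_l; lra.
    lra.
  have : s * norm (vsub a' a) < s * e by apply: Rmult_lt_compat_l; lra.
  lra.
have cnclT : is_cone clT.
  split=> [e e0|a s ha s0 e e0].
    by exists vzero; split; [case: cnT|have -> : vsub (@vzero J) vzero = vzero; [vring|rewrite norm0]].
  have e1 : 0 < e / (s + 1) by apply: Rdiv_lt_0_compat; lra.
  have [a' [Ta ha']] := ha _ e1; exists (vscale s a'); split; first by case: cnT => _; apply.
  have -> : vsub (vscale s a') (vscale s a) = vscale s (vsub a' a) by vring.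
  rewrite normZ Rabs_pos_eq //.
  have ee : e = e / (s + 1) * (s + 1) by field; lra.
  move: (e / (s + 1)) (norm (vsub a' a)) ee e1 ha' => c x -> c0 xc; nra.
have [tau [ht pt e0]] := cone_projection (mapply M u) cclT cvclT cnclT.
have key := closure_inequality r0 (h u) ht.
set b := mapply M u in pt e0 key.
have polT mu : polar clT mu -> polar T mu.
  move=> pmu a Ta; apply: pmu => e e1; exists a; split=> //.
  by have -> : vsub a a = vzero; [vring|rewrite norm0].
(* The variational inequality of the projection, read through the adjoint: [mu0] maximizes [<., b>]
   over the admissible multipliers. *)
have hmax mu : polar T mu -> norm mu <= r -> inner mu b <= inner mu0 b.
  move=> p1 p2; have := hy (tapply M mu) ltac:(by exists mu).
  by rewrite innerBr (innerC _ (tapply M mu)) (innerC _ (tapply M mu0)) !inner_tapply -/b; lra.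
have hxu : inner xs u = inner u u + inner mu0 b.
  by rewrite /b -inner_tapply -innerDl; congr (inner _ u); rewrite /u; vring.
have db : norm (vsub b tau) * norm (vsub b tau) = inner (vsub b tau) b.
  by rewrite norm_sqr innerBr e0; ring.
have nb := norm_ge0 (vsub b tau).
(* The residual [b - tau], rescaled to norm [r], is itself an admissible multiplier and attains [r]
   times the distance. *)
have hb : r * norm (vsub b tau) <= inner mu0 b.
  case: (Rle_lt_dec (norm (vsub b tau)) 0) => hn.
    have := hmax vzero p0 ltac:(by rewrite norm0); rewrite inner0l; nra.
  have := hmax (vscale (r / norm (vsub b tau)) (vsub b tau)).
  have q0 : 0 <= r / norm (vsub b tau).
    by apply: Rmult_le_pos => //; apply: Rlt_le; exact: Rinv_0_lt_compat.
  move=> /(_ (polar_scale q0 (polT _ pt))).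
  rewrite normZ (Rabs_pos_eq _ q0) innerZl -db.
  have -> : r / norm (vsub b tau) * norm (vsub b tau) = r by field; lra.
  have -> : r / norm (vsub b tau) * (norm (vsub b tau) * norm (vsub b tau)) = r * norm (vsub b tau)
    by field; lra.
  by apply; lra.
(* [<u, u> + <mu0, b> = <xs, u> <= r * norm (b - tau) <= <mu0, b>], by [hxu], [key] and [hb]. *)
have : inner u u <= 0 by lra.
by move=> h0; apply: norm_eq0; apply: norm_le_of_sqr; lra.
Qed.

(** * Taylor expansions along sequences *)

(** The directional derivative of the Jacobian along [v], as a matrix; [mapply (dmat T v) v] is the
    quadratic term [T(v, v)]. *)
Definition dmat {I J : finType} (T : J -> I -> I -> R) (v : Vec I) : Mat J I :=
  fun j i => mapply (ten2mat T) v (j, i).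

Lemma derivable_inner_seg {I J : finType} (f : Vec I -> Vec J) x D M (mu : Vec J) s :
  fderiv f (vadd x (vscale s D)) M ->
  derivable_pt_lim (fun r => inner mu (f (vadd x (vscale r D)))) s (inner mu (mapply M D)).
Proof.
move=> df e e0.
have nD := norm_ge0 D; have nm := norm_ge0 mu.
have p0 : 0 < (norm mu + 1) * (norm D + 1) by nra.
have e1 : 0 < e / ((norm mu + 1) * (norm D + 1)) by apply: Rdiv_lt_0_compat.
have [de [de0 hde]] := df _ e1.
have d0 : 0 < de / (norm D + 1) by apply: Rdiv_lt_0_compat; lra.
exists (mkposreal _ d0) => h h0 /= hh.
have := hde (vadd x (vscale (s + h) D)).
have -> : vsub (vadd x (vscale (s + h) D)) (vadd x (vscale s D)) = vscale h D by vring.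
rewrite normZ mapplyZ.
have hlt : Rabs h * norm D < de.
  have de' : de = de / (norm D + 1) * (norm D + 1) by field; lra.
  have := Rabs_pos h; move: (de / (norm D + 1)) de' hh => c -> hc; nra.
move=> /(_ hlt); set fd := vsub (f _) (f _) => hb.
have -> : (inner mu (f (vadd x (vscale (s + h) D))) - inner mu (f (vadd x (vscale s D)))) / h -
    inner mu (mapply M D) = / h * inner mu (vsub fd (vscale h (mapply M D))).
  by rewrite /fd !innerE; field.
rewrite Rabs_mult Rabs_inv.
have ha : 0 < Rabs h by exact: Rabs_pos_lt.
apply: (Rmult_lt_reg_l (Rabs h)) => //.
rewrite -Rmult_assoc Rinv_r ?Rmult_1_l; last lra.
apply: (Rle_lt_trans _ _ _ (Cauchy_Schwarz_abs _ _)).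
have ee : e = e / ((norm mu + 1) * (norm D + 1)) * ((norm mu + 1) * (norm D + 1)) by field; lra.
move: hb e1; rewrite [X in _ -> _ -> _ < _ * X]ee.
move: (e / _) (norm (vsub _ _)) => c y hy c0.
have := Rmult_lt_0_compat _ _ c0 ha => ca.
apply: (Rle_lt_trans _ (norm mu * (c * (Rabs h * norm D)))); first nra.
have -> : Rabs h * (c * ((norm mu + 1) * (norm D + 1))) =
  c * Rabs h * ((norm mu + 1) * (norm D + 1)) by ring.
have -> : norm mu * (c * (Rabs h * norm D)) = c * Rabs h * (norm mu * norm D) by ring.
apply: Rmult_lt_compat_l => //; nra.
Qed.

(** The mean value theorem needs a scalar function, so [f] is first paired with a fixed [mu]; the
    intermediate [s] depends on [mu]. *)
Lemma MVT_inner {I J : finType} (f : Vec I -> Vec J) (Df : Vec I -> Mat J I) x D (mu : Vec J) :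
  (forall s, 0 <= s <= 1 -> fderiv f (vadd x (vscale s D)) (Df (vadd x (vscale s D)))) ->
  exists s, 0 <= s <= 1 /\
    inner mu (vsub (f (vadd x D)) (f x)) = inner mu (mapply (Df (vadd x (vscale s D))) D).
Proof.
move=> h.
have [s [hs s01]] := MVT_cor2 _ (fun s => inner mu (mapply (Df (vadd x (vscale s D))) D))
  0 1 ltac:(lra) (fun c hc => derivable_inner_seg mu (h c hc)).
exists s; split; first lra.
have e1 : vadd x (vscale 1 D) = vadd x D by vring.
have e0 : vadd x (vscale 0 D) = x by vring.
by move: hs; rewrite e1 e0 innerBr; lra.
Qed.

(** Mean value theorem for [<mu, f(x + s D)> - a s - b s^2/2]. The remainder is the error made in
    linearizing the Jacobian at [x], which [jacobian_seq] controls. *)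
Lemma taylor2_inner {I J : finType} (f : Vec I -> Vec J) (Df : Vec I -> Mat J I) T x D (mu : Vec J) :
  (forall s, 0 <= s <= 1 -> fderiv f (vadd x (vscale s D)) (Df (vadd x (vscale s D)))) ->
  exists s, 0 <= s <= 1 /\
    inner mu (vsub (vsub (f (vadd x D)) (f x)) (mapply (Df x) D)) =
    / 2 * inner mu (mapply (dmat T D) D) +
    inner mu (vsub (vsub (mapply (Df (vadd x (vscale s D))) D) (mapply (Df x) D))
      (vscale s (mapply (dmat T D) D))).
Proof.
move=> h.
set a := inner mu (mapply (Df x) D); set b := inner mu (mapply (dmat T D) D).
have dphi c : 0 <= c <= 1 ->
  derivable_pt_lim (fun s => inner mu (f (vadd x (vscale s D))) - (a * s + / 2 * b * (s * s))) c
    (inner mu (mapply (Df (vadd x (vscale c D))) D) - (a * 1 + / 2 * b * (1 * c + c * 1))).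
  move=> hc; apply: derivable_pt_lim_minus; first exact: derivable_inner_seg (h c hc).
  have hid := derivable_pt_lim_id c.
  apply: derivable_pt_lim_plus; first exact: derivable_pt_lim_scal.
  apply: (derivable_pt_lim_scal (fun s => s * s)).
  exact: (derivable_pt_lim_mult id id c 1 1 hid hid).
have [s [hs s01]] := MVT_cor2 _ _ 0 1 ltac:(lra) dphi.
exists s; split; first lra.
have e1 : vadd x (vscale 1 D) = vadd x D by vring.
have e0 : vadd x (vscale 0 D) = x by vring.
by move: hs; rewrite e1 e0 !(innerBr, innerZr) -/a -/b; lra.
Qed.

(** Testing with unit vectors brings scalar expansions, whose intermediate points depend on [mu],
    back to vectors. *)
Lemma vcv_of_inner {I : finType} (u : nat -> Vec I) x :
  (forall mu, Un_cv (fun k => inner mu (u k)) (inner mu x)) -> vcv u x.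
Proof.
move=> h i; have := h (fun j => if j == i then 1 else 0).
have E (y : Vec I) : inner (fun j => if j == i then 1 else 0) y = y i.
  rewrite /inner /vsum (bigD1 i) //= eqxx big1 ?Rplus_0_r ?Rmult_1_l //.
  by move=> j /negbTE ->; rewrite Rmult_0_l.
by rewrite E; apply: cv_ext => k; rewrite E.
Qed.

Lemma jacobian_seq {I J : finType} (Df : Vec I -> Mat J I) T x (t : nat -> R) (v : nat -> Vec I) B :
  fderiv (fun y => mat2vec (Df y)) x (ten2mat T) ->
  (forall k, 0 < t k) -> Un_cv t 0 -> (forall k, norm (v k) <= B) ->
  forall j i, Un_cv (fun k => / t k * (Df (vadd x (vscale (t k) (v k))) j i - Df x j i)
     - dmat T (v k) j i) 0.
Proof. move=> df t0 ct bv j i; exact: (fderiv_seq df t0 ct bv (j, i)). Qed.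

Lemma vcv_bounded {I : finType} (u : nat -> Vec I) x : vcv u x -> exists B, forall k, norm (u k) <= B.
Proof.
move=> /cv_norm cu; have [B [_ hB]] := maj_by_pos _ (exist _ _ cu).
by exists B => k; have := hB k; rewrite Rabs_pos_eq //; exact: norm_ge0.
Qed.

(** The intermediate parameters [s k] need not converge: they are absorbed into the bounded
    directions [s k * v k], along which the error [X k] of the Jacobian quotient tends to 0. *)
Lemma taylor2_seq {I J : finType} (f : Vec I -> Vec J) (Df : Vec I -> Mat J I) T x de
    (t : nat -> R) (v : nat -> Vec I) v0 :
  0 < de -> (forall z, norm (vsub z x) < de -> fderiv f z (Df z)) ->
  fderiv (fun y => mat2vec (Df y)) x (ten2mat T) ->
  (forall k, 0 < t k) -> Un_cv t 0 -> vcv v v0 ->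
  vcv (fun k => vscale (/ (t k * t k)) (vsub (vsub (f (vadd x (vscale (t k) (v k)))) (f x))
        (vscale (t k) (mapply (Df x) (v k)))))
      (vscale (/ 2) (mapply (dmat T v0) v0)).
Proof.
move=> de0 hf hT t0 ct cv; apply: vcv_of_inner => mu.
have [B hB] := vcv_bounded cv.
have cz : vcv (fun k => vscale (t k) (v k)) vzero by exact: vcv_null cv.
have ev := vcv_eventually cz de0.
have ch s := choice_seq (P := fun k s => 0 <= s <= 1 /\ (norm (vsub (vscale (t k) (v k)) vzero) < de ->
   inner mu (vsub (vsub (f (vadd x (vscale (t k) (v k)))) (f x)) (mapply (Df x) (vscale (t k) (v k)))) =
    / 2 * inner mu (mapply (dmat T (vscale (t k) (v k))) (vscale (t k) (v k))) +
    inner mu (vsub (vsub (mapply (Df (vadd x (vscale s (vscale (t k) (v k))))) (vscale (t k) (v k)))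
       (mapply (Df x) (vscale (t k) (v k))))
      (vscale s (mapply (dmat T (vscale (t k) (v k))) (vscale (t k) (v k))))))) s.
have [|s hs] := ch.
  move=> k; case: (Rlt_le_dec (norm (vsub (vscale (t k) (v k)) vzero)) de) => hk; last first.
    by exists 0; split; lra.
  have [|s [hs1 hs2]] := @taylor2_inner _ _ f Df T x (vscale (t k) (v k)) mu.
    move=> s hs; apply: hf.
    have -> : vsub (vadd x (vscale s (vscale (t k) (v k)))) x = vscale s (vscale (t k) (v k)) by vring.
    have E : vsub (vscale (t k) (v k)) vzero = vscale (t k) (v k) by vring.
    rewrite normZ Rabs_pos_eq; last lra.
    by move: hk; rewrite E; have := norm_ge0 (vscale (t k) (v k)); nra.
  by exists s.
pose X k : Mat J I := fun j i =>
  / t k * (Df (vadd x (vscale (t k) (vscale (s k) (v k)))) j i - Df x j i) - dmat T (vscale (s k) (v k)) j i.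
have cX : forall j i, Un_cv (fun k => X k j i) ((fun _ _ => 0) j i).
  apply: (jacobian_seq (B := B) hT t0 ct) => k; have [hs1 _] := hs k.
  by rewrite normZ Rabs_pos_eq; [have := hB k; have := norm_ge0 (v k); nra|lra].
have cD : forall j i, Un_cv (fun k => dmat T (v k) j i) (dmat T v0 j i).
  by move=> j i; exact: (vcv_mapplyc (ten2mat T) cv (j, i)).
have lim : Un_cv (fun k => / 2 * inner mu (mapply (dmat T (v k)) (v k)) + inner mu (mapply (X k) (v k)))
    (inner mu (vscale (/ 2) (mapply (dmat T v0) v0))).
  have -> : inner mu (vscale (/ 2) (mapply (dmat T v0) v0)) =
     / 2 * inner mu (mapply (dmat T v0) v0) + inner mu (mapply (fun _ _ => 0) v0).
    rewrite innerZr; have -> : mapply (fun (_ : J) (_ : I) => 0) v0 = vzero.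
      apply: functional_extensionality => j; rewrite /mapply -[RHS](@vsum0 I).
      by apply: eq_vsum => i; ring.
    by rewrite inner0r; ring.
  apply: CV_plus.
    by apply: cvZ; apply: cv_inner; [exact: vcv_const|exact: vcv_mapply].
  by apply: cv_inner; [exact: vcv_const|exact: vcv_mapply].
apply/cvP => e e0; move/cvP: lim => /(_ e e0) lim.
apply: eventually_mono (eventually_and ev lim) => k [hk].
suff -> : inner mu (vscale (/ (t k * t k)) (vsub (vsub (f (vadd x (vscale (t k) (v k)))) (f x))
   (vscale (t k) (mapply (Df x) (v k))))) =
   / 2 * inner mu (mapply (dmat T (v k)) (v k)) + inner mu (mapply (X k) (v k)) by [].
rewrite -mapplyZ innerZr; have [_ /(_ hk) ->] := hs k.
have tk := t0 k.
have Es : vscale (s k) (vscale (t k) (v k)) = vscale (t k) (vscale (s k) (v k)) by vring.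
have Ed c w : dmat T (vscale c w) = (fun j i => c * dmat T w j i).
  by apply: functional_extensionality => j; apply: functional_extensionality => i; rewrite /dmat mapplyZ.
have Em c (M : Mat J I) w : mapply (fun j i => c * M j i) w = vscale c (mapply M w).
  apply: functional_extensionality => j; rewrite /mapply /vscale -vsumZ; by apply: eq_vsum => i; ring.
have EX : mapply (X k) (v k) = vsub (vscale (/ t k) (vsub
     (mapply (Df (vadd x (vscale (t k) (vscale (s k) (v k))))) (v k)) (mapply (Df x) (v k))))
     (vscale (s k) (mapply (dmat T (v k)) (v k))).
  have Es' : vscale (s k) (mapply (dmat T (v k)) (v k)) = mapply (dmat T (vscale (s k) (v k))) (v k).
    by rewrite Ed Em.
  rewrite Es' /X; apply: functional_extensionality => j.
  rewrite !vsubE /vadd /vscale /mapply -!vsumZ -vsumD -!vsumZ -vsumD.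
  by apply: eq_vsum => i; ring.
rewrite Es Ed Em EX !mapplyZ !innerE; field; lra.
Qed.

(** * Tangents and normals of the constraint system *)

Lemma eventually_subseq (phi : nat -> nat) P :
  (forall k, (k <= phi k)%N) -> eventually P -> eventually (fun k => P (phi k)).
Proof. move=> hp [N h]; exists N => k hk; apply: h; exact: leq_trans hk (hp k). Qed.

Lemma tangent_coneI {I : finType} (S : Vec I -> Prop) x w (t : nat -> R) (wk : nat -> Vec I) :
  (forall k, 0 < t k) -> Un_cv t 0 -> vcv wk w ->
  eventually (fun k => S (vadd x (vscale (t k) (wk k)))) -> tangent_cone S x w.
Proof.
move=> t0 ct cw [N hN].
have hp k : (k <= k + N)%N by exact: leq_addr.
exists (fun k => t (k + N)%N), (fun k => wk (k + N)%N); split=> //.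
split; first exact: (cv_subseq hp ct).
split; first by apply/vcv_norm; exact: (vcv_subseq hp cw).
by move=> k; apply: hN; exact: leq_addl.
Qed.

Lemma tangent_cone_mem {I : finType} (S : Vec I -> Prop) x w :
  tangent_cone S x w -> exists t wk, [/\ forall k, 0 < t k, Un_cv t 0, vcv wk w &
    forall k, S (vadd x (vscale (t k) (wk k)))].
Proof. by move=> [t [wk [h1 [h2 [/vcv_norm h3 h4]]]]]; exists t, wk. Qed.

Lemma reg_normalI {I : finType} (S : Vec I -> Prop) x xs :
  S x -> (forall z, S z -> inner xs (vsub z x) <= 0) -> reg_normal S x xs.
Proof.
move=> Sx h; split=> // e e0; exists 1; split; [lra|move=> z Sz _].
have := h z Sz; have := norm_ge0 (vsub z x); nra.
Qed.

Lemma reg_normal_dir {I : finType} (S : Vec I -> Prop) x xs d :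
  reg_normal S x xs -> (forall s, 0 < s <= 1 -> S (vadd x (vscale s d))) -> inner xs d <= 0.
Proof.
move=> [_ hN] hS; apply: (@le0_of_small_mul _ (norm d)) => e e0.
have [de [de0 hde]] := hN e ltac:(lra).
have nd := norm_ge0 d.
have s0 : 0 < Rmin 1 (de / (norm d + 1)).
  by apply: Rmin_glb_lt; [lra|apply: Rdiv_lt_0_compat; lra].
set s := Rmin _ _ in s0.
have s1 : s <= 1 by exact: Rmin_l.
have s2 : s * (norm d + 1) <= de.
  have -> : de = de / (norm d + 1) * (norm d + 1) by field; lra.
  by apply: Rmult_le_compat_r; [lra|exact: Rmin_r].
have := hde _ (hS s ltac:(lra)).
have -> : vsub (vadd x (vscale s d)) x = vscale s d by vring.
rewrite normZ innerZr Rabs_pos_eq; last lra.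
move=> /(_ ltac:(nra)) h.
by apply: (Rmult_le_reg_l s) => //; lra.
Qed.

Ltac vlra := unfold reverse_coercion in *; lra.
Ltac vnra := unfold reverse_coercion in *; nra.

Section Blocks.
Context {m n d : nat}.
Implicit Types (M : Mat 'I_d (ZI m n)).

Lemma mapply_grad_x M u : mapply (grad_x M) u = mapply M (vpair vzero u).
Proof.
apply: functional_extensionality => e; rewrite /mapply vsum_sum.
have -> : vsum (fun i : 'I_m => M e (inl i) * vpair vzero u (inl i)) = 0.
  by rewrite -[RHS](@vsum0 'I_m); apply: eq_vsum => i; rewrite /vpair /vzero; ring.
by rewrite Rplus_0_l.
Qed.

Lemma mapply_vpair M q u : mapply M (vpair q u) = vadd (mapply (grad_p M) q) (mapply (grad_x M) u).
Proof. by apply: functional_extensionality => e; rewrite /mapply vsum_sum. Qed.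

Lemma vsnd_tapply M mu : vsnd (tapply M mu) = tapply (grad_x M) mu.
Proof. by []. Qed.

Lemma inner_vpair0 (w : Vec (ZI m n)) u : inner w (vpair vzero u) = inner (vsnd w) u.
Proof. by rewrite {1}(vpair_eta w) inner_vpair inner0r Rplus_0_l. Qed.

Lemma hess_x_multE (T : 'I_d -> ZI m n -> ZI m n -> R) mu v :
  hess_x_mult T mu v = tapply (grad_x (dmat T v)) mu.
Proof.
by apply: functional_extensionality => j; apply: eq_vsum => e; rewrite Rmult_comm.
Qed.

Lemma hess_vvE (T : 'I_d -> ZI m n -> ZI m n -> R) v : hess_vv T v = mapply (dmat T v) v.
Proof.
apply: functional_extensionality => e; apply: eq_vsum => i.
rewrite Rmult_comm /dmat /mapply -vsumZ; apply: eq_vsum => k; rewrite /ten2mat /=; ring.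
Qed.

Lemma norm_dmat (T : 'I_d -> ZI m n -> ZI m n -> R) v :
  norm (mat2vec (dmat T v)) <= norm (mat2vec (ten2mat T)) * norm v.
Proof.
have -> : mat2vec (dmat T v) = mapply (ten2mat T) v by apply: functional_extensionality => -[].
exact: norm_mapply.
Qed.
End Blocks.

Lemma fderiv_calm {I J : finType} (f : Vec I -> Vec J) x M : fderiv f x M ->
  exists de, 0 < de /\ forall y, norm (vsub y x) < de ->
    norm (vsub (f y) (f x)) <= (norm (mat2vec M) + 1) * norm (vsub y x).
Proof.
move=> df; have [de [de0 hde]] := df 1 ltac:(lra).
exists de; split=> // y /hde.
set a := vsub (f _) _; set b := mapply _ _ => h.
have := norm_triangle (vsub a b) b; have := norm_mapply M (vsub y x).
have -> : vadd (vsub a b) b = a by vring.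
rewrite -/b; lra.
Qed.

Lemma fderiv_cv {I J : finType} (f : Vec I -> Vec J) x M u :
  fderiv f x M -> vcv u x -> vcv (fun k => f (u k)) (f x).
Proof.
move=> /fderiv_calm [de [de0 hde]] cu.
apply: (vcv_squeezeR (e := fun k => (norm (mat2vec M) + 1) * norm (vsub (u k) x))).
  by apply: eventually_mono (vcv_eventually cu de0) => k; exact: hde.
rewrite -(Rmult_0_r (norm (mat2vec M) + 1)); apply: cvZ; exact/vcv_norm.
Qed.

Lemma inner_dmatD {m n d : nat} (T : 'I_d -> ZI m n -> ZI m n -> R) mu a s b c :
  inner mu (mapply (dmat T (vadd a (vscale s b))) c) =
  inner mu (mapply (dmat T a) c) + s * inner mu (mapply (dmat T b) c).
Proof.
rewrite -innerZr -innerDr; congr inner; apply: functional_extensionality => e.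
rewrite /vadd /vscale /mapply -vsumZ -vsumD; apply: eq_vsum => i.
rewrite /dmat mapplyD mapplyZ /vadd /vscale; ring.
Qed.

(** The proximal normal inequality: without convexity a quadratic term remains, and it is negligible
    in the definition of a regular normal. *)
Lemma nearest_point_prox {I : finType} (b y y' : Vec I) :
  norm (vsub b y) <= norm (vsub b y') ->
  2 * inner (vsub b y) (vsub y' y) <= inner (vsub y' y) (vsub y' y).
Proof.
have -> : vsub b y' = vsub (vsub b y) (vsub y' y) by vring.
move: (vsub b y) (vsub y' y) => p q h.
have h2 : inner p p <= inner (vsub p q) (vsub p q).
  rewrite -!norm_sqr; have := norm_ge0 p; nra.
by rewrite !innerE (innerC q p) in h2; lra.
Qed.

(** * The reduced system, with [Omega] equal to the preimage of [K] under [G] near [zbar] *)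

Section Reduced.
Context {m n d : nat} (G : Vec (ZI m n) -> Vec 'I_d) (DG : Vec (ZI m n) -> Mat 'I_d (ZI m n))
  (T : 'I_d -> ZI m n -> ZI m n -> R) (K : Vec 'I_d -> Prop) (Omega : Vec (ZI m n) -> Prop)
  (pbar : Vec 'I_m) (xbar : Vec 'I_n) (de : R).
Let zbar := vpair pbar xbar.
Let A := DG zbar.
Context (de0 : 0 < de)
  (G1 : forall z, norm (vsub z zbar) < de -> fderiv G z (DG z))
  (G2 : fderiv (fun z => mat2vec (DG z)) zbar (ten2mat T))
  (GO : forall z, norm (vsub z zbar) < de -> (Omega z <-> K (G z)))
  (G0 : G zbar = vzero)
  (clK : is_closed K) (cvK : is_convex K) (cnK : is_cone K)
  (RS : robinson_stable G K pbar xbar).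

(** Normality of [xs] is tested along [x + t (u + e)], where Robinson stability supplies a
    correction [e] whose norm is, in the limit, at most [kappa] times the distance from the
    linearized value to [tau]. This is the estimate that [bounded_multiplier] requires. One [kappa]
    serves all points near [zbar], so multipliers along a sequence have cluster points. *)
Lemma normal_multiplier : exists rho kappa, 0 < rho /\ 0 <= kappa /\ forall p x xs,
  norm (vsub (vpair p x) zbar) < rho -> Omega (vpair p x) ->
  reg_normal (fun x' => Omega (vpair p x')) x xs ->
  exists mu, [/\ polar K mu, inner mu (G (vpair p x)) = 0, norm mu <= kappa * norm xs &
    tapply (grad_x (DG (vpair p x))) mu = xs].
Proof.
have [kappa [dW [dU [k0 [dW0 [dU0 hRS]]]]]] := RS.
exists (Rmin de (Rmin dW dU)), kappa; split; first by do 2?apply: Rmin_glb_lt.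
split=> // p x xs hz Oz [_ hN].
have hzde : norm (vsub (vpair p x) zbar) < de by have := Rmin_l de (Rmin dW dU); vlra.
have hzW : norm (vsub p pbar) < dW.
  have := norm_vpair_l (vsub p pbar) (vsub x xbar); rewrite -vpairB -/zbar.
  have := Rmin_r de (Rmin dW dU); have := Rmin_l dW dU; vlra.
have hzU : norm (vsub x xbar) < dU.
  have := norm_vpair_r (vsub p pbar) (vsub x xbar); rewrite -vpairB -/zbar.
  have := Rmin_r de (Rmin dW dU); have := Rmin_r dW dU; vlra.
set z := vpair p x; set y := G z.
have Ky : K y by apply/GO.
(* The cone [K - R_+ y] of directions along which [y] can move inside [K]. A functional in its polar
   lies in the polar of [K] and vanishes at [y], so complementarity comes with the multiplier. *)
pose T' tau := exists k s, [/\ K k, 0 <= s & tau = vsub k (vscale s y)].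
have cvT : is_convex T'.
  move=> _ _ s [k1 [s1 [Kk1 s10 ->]]] [k2 [s2 [Kk2 s20 ->]]] s01.
  exists (vadd (vscale s k1) (vscale (1 - s) k2)), (s * s1 + (1 - s) * s2).
  by split; [exact: cvK|vnra|vring].
have cnT : is_cone T'.
  have [K0 sc] := cnK; split.
    by exists vzero, 0; split=> //; [vlra|vring].
  move=> _ s [k1 [s1 [Kk1 s10 ->]]] s0; exists (vscale s k1), (s * s1).
  by split; [exact: sc|vnra|vring].
have xs0 := norm_ge0 xs.
have [||mu [pT nm e]] := @bounded_multiplier _ _ (grad_x (DG z)) T' xs (kappa * norm xs) _ cvT cnT.
- by vnra.
- move=> u _ [k [s [Kk s0 ->]]]; set tau := vsub k _.
  rewrite mapply_grad_x; set v := vpair vzero u.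
  set B := mapply _ v.
  pose t := small.
  have t0 k' : 0 < t k' by exact: small_gt0.
  pose q j := vsub (vscale (/ t j) (vsub (G (vadd z (vscale (t j) v))) y)) tau.
  have cq : vcv q (vsub B tau).
    have := vcvD (fderiv_seq (B := norm v) (G1 hzde : fderiv G z (DG z)) t0 cv_small (v := fun _ => v)
      (fun _ => Rle_refl _)) (vcv_const (vsub B tau)).
    have -> : vadd vzero (vsub B tau) = vsub B tau by vring.
    by apply: vcv_ext => j; rewrite /q /B /y; vring.
  pose f j := kappa * norm (q j) + t j.
  have cf : Un_cv f (kappa * norm (vsub B tau)).
    have := CV_plus _ _ _ _ (cvZ kappa (cv_norm cq)) cv_small; by rewrite Rplus_0_r.
  have ezx a : vadd z (vscale a v) = vpair p (vadd x (vscale a u)).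
    by rewrite /z /v vpairZ vpairD; congr vpair; vring.
  have cx : vcv (fun j => vsub (vadd x (vscale (t j) u)) xbar) (vsub x xbar).
    apply: vcvB; last exact: vcv_const.
    have := vcvD (vcv_const x) (vcv_null cv_small (vcv_const u)).
    by have -> : vadd x vzero = x by vring.
  have ok1 : eventually (fun j => norm (vsub (vadd x (vscale (t j) u)) xbar) < dU).
    exact: cv_eventually_lt (cv_norm cx) hzU.
  have ok2 : eventually (fun j => t j * s < 1).
    apply: (cv_eventually_lt (a := 0 * s)); last vlra.
    by apply: CV_mult; [exact: cv_small|exact: cv_const].
  have ok := eventually_and ok1 ok2.
  have ex j : exists e, norm (vsub (vadd x (vscale (t j) u)) xbar) < dU /\ t j * s < 1 ->
      K (G (vpair p (vadd x (vscale (t j) (vadd u e))))) /\ norm e <= f j.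
    case: (classic (norm (vsub (vadd x (vscale (t j) u)) xbar) < dU /\ t j * s < 1)) => [[h1 h2]|no];
      last by exists vzero.
    have tj := t0 j.
    have Kl : K (vadd y (vscale (t j) tau)).
      have -> : vadd y (vscale (t j) tau) = vadd (vscale (1 - t j * s) y) (vscale (t j) k).
        by rewrite /tau; vring.
      by case: (cnK) => _ sc; apply: cone_add => //; apply: sc => //; vlra.
    (* The slack [t^2] in the distance estimate becomes the summand [t j] of [f j] after division by
       [t]. *)
    have [x' [Kx' hx']] := hRS p _ hzW h1 _ Kl (t j * t j) ltac:(vnra).
    exists (vsub (vscale (/ t j) (vsub x' x)) u) => _.
    have -> : vadd x (vscale (t j) (vadd u (vsub (vscale (/ t j) (vsub x' x)) u))) = x'.
      by apply: functional_extensionality => i; rewrite /vadd /vsub /vscale; field; vlra.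
    split=> //; apply: (Rmult_le_reg_l (t j)) => //.
    have tE (b : Vec 'I_n) : t j * norm b = norm (vscale (t j) b) by rewrite normZ Rabs_pos_eq; vlra.
    have tE' (b : Vec 'I_d) : t j * norm b = norm (vscale (t j) b) by rewrite normZ Rabs_pos_eq; vlra.
    have -> : t j * norm (vsub (vscale (/ t j) (vsub x' x)) u) = norm (vsub (vadd x (vscale (t j) u)) x').
      rewrite tE norm_subC; congr norm.
      by apply: functional_extensionality => i; rewrite /vadd /vsub /vscale; field; vlra.
    have E2 : t j * norm (q j) =
        norm (vsub (G (vpair p (vadd x (vscale (t j) u)))) (vadd y (vscale (t j) tau))).
      rewrite tE' /q ezx; congr norm.
      by apply: functional_extensionality => i; rewrite /vadd /vsub /vscale; field; vlra.
    by rewrite -E2 in hx'; apply: (Rle_trans _ _ _ (Rlt_le _ _ hx')); apply: Req_le; rewrite /f; ring.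
  have [e he] := choice_seq ex.
  suff: inner xs u - norm xs * (kappa * norm (vsub B tau)) <= 0.
    move=> h; change (inner xs u <= kappa * norm xs * norm (vsub B tau)); vlra.
  apply: (@le0_of_small_mul _ (norm u + kappa * norm (vsub B tau))) => ep ep0.
  have [dl [dl0 hdl]] := hN ep ltac:(vlra).
  suff: inner xs u <= norm xs * (kappa * norm (vsub B tau)) + ep * (norm u + kappa * norm (vsub B tau)) by vlra.
  apply: (cv_le (cv_const (inner xs u)) (v := fun j => norm xs * f j + ep * (norm u + f j))).
    apply: CV_plus; first exact: cvZ.
    by apply: cvZ; apply: CV_plus => //; exact: cv_const.
  have cs : Un_cv (fun j => t j * (norm u + f j)) 0.
    rewrite -(Rmult_0_l (norm u + kappa * norm (vsub B tau))).
    by apply: CV_mult; [exact: cv_small|apply: CV_plus => //; exact: cv_const].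
  have ok3 := cv_eventually_lt cs dl0.
  have ok4 : eventually (fun j => t j * (norm u + f j) < de - norm (vsub z zbar)).
    by apply: cv_eventually_lt cs _; rewrite /z; vlra.
  apply: eventually_mono (eventually_and ok (eventually_and ok3 ok4)) => j [oj [h3 h4]].
  have [Kx hf] := he j oj.
  have tj := t0 j.
  have nue := norm_triangle u (e j).
  set x' := vadd x _ in Kx.
  have E : vsub x' x = vscale (t j) (vadd u (e j)) by rewrite /x'; vring.
  have nE : norm (vsub x' x) = t j * norm (vadd u (e j)) by rewrite E normZ Rabs_pos_eq; vlra.
  have h5 : norm (vsub x' x) <= t j * (norm u + f j); first by rewrite nE; apply: Rmult_le_compat_l; vlra.
  have Ox : Omega (vpair p x').
    apply/GO => //.
    apply: (Rle_lt_trans _ _ _ (norm_sub_triangle _ z _)).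
    have -> : vsub (vpair p x') z = vpair vzero (vsub x' x).
      by rewrite /z vpairB; congr vpair; vring.
    rewrite norm_vpair0; vlra.
  have hd : norm (vsub x' x) < dl by vlra.
  have := hdl x' Ox hd; rewrite nE E innerZr innerDr => h6.
  have h7 : inner xs u + inner xs (e j) <= ep * norm (vadd u (e j)).
    by apply: (Rmult_le_reg_l (t j)) => //; vlra.
  have h8 := Cauchy_Schwarz_abs xs (e j).
  have h9 : norm xs * norm (e j) <= norm xs * f j by apply: Rmult_le_compat_l.
  have h10 : ep * norm (vadd u (e j)) <= ep * (norm u + f j) by apply: Rmult_le_compat_l; vlra.
  move: h8; split_Rabs; vlra.
have K0 : K vzero by case: cnK.
exists mu; split=> //.
- move=> k Kk; apply: pT; exists k, 0; split=> //; [vlra|vring].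
- have h1 : inner mu y <= 0 by apply: pT; exists y, 0; split=> //; [vlra|vring].
  have h2 : inner mu (vopp y) <= 0 by apply: pT; exists vzero, 1; split=> //; [vlra|vring].
  by rewrite innerNr in h2; vlra.
Qed.

Lemma zbar_shift s q u : vadd zbar (vscale s (vpair q u)) =
  vpair (vadd pbar (vscale s q)) (vadd xbar (vscale s u)).
Proof. by rewrite vpairZ vpairD. Qed.

Lemma near_zbar (t : nat -> R) (v : nat -> Vec (ZI m n)) v0 e : 0 < e -> Un_cv t 0 -> vcv v v0 ->
  eventually (fun k => norm (vsub (vadd zbar (vscale (t k) (v k))) zbar) < e).
Proof.
move=> e0 ct cv; apply: vcv_eventually e0.
have := vcvD (vcv_const zbar) (vcv_null ct cv).
by have -> : vadd zbar vzero = zbar by vring.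
Qed.

Lemma G_quotient (t : nat -> R) (v : nat -> Vec (ZI m n)) v0 :
  (forall k, 0 < t k) -> Un_cv t 0 -> vcv v v0 ->
  vcv (fun k => vscale (/ t k) (G (vadd zbar (vscale (t k) (v k))))) (mapply A v0).
Proof.
move=> t0 ct cv; have [B hB] := vcv_bounded cv.
have zz : norm (vsub zbar zbar) < de.
  by have -> : vsub zbar zbar = vzero; [vring|rewrite norm0].
have := vcvD (fderiv_seq (G1 zz) t0 ct hB) (vcv_mapplyc A cv).
have -> : vadd vzero (mapply A v0) = mapply A v0 by vring.
by apply: vcv_ext => k; rewrite G0 /A; vring.
Qed.

Lemma G_quotient_mem (t : nat -> R) (v : nat -> Vec (ZI m n)) v0 :
  (forall k, 0 < t k) -> Un_cv t 0 -> vcv v v0 ->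
  eventually (fun k => K (G (vadd zbar (vscale (t k) (v k))))) -> K (mapply A v0).
Proof.
move=> t0 ct cv ev; apply: closed_vcv clK (G_quotient t0 ct cv) _.
apply: eventually_mono ev => k Kk; case: (cnK) => _; apply=> //.
by apply: Rlt_le; exact: Rinv_0_lt_compat.
Qed.

Lemma tangent_cone_linearized w : tangent_cone Omega zbar w -> K (mapply A w).
Proof.
move=> /tangent_cone_mem [t [wk [t0 ct cw h]]].
apply: (G_quotient_mem t0 ct cw).
by apply: eventually_mono (near_zbar de0 ct cw) => k hk; apply/GO.
Qed.

(** Feasibility is restored by moving [x] alone, so the parameter of the sequence is kept. The slack
    in the distance estimate is taken as [t^3] to stay negligible at the second-order scale
    [t^2]. *)
Lemma robinson_corrector : exists kappa, 0 <= kappa /\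
  forall (t : nat -> R) (v : nat -> Vec (ZI m n)) v0 (l : nat -> Vec 'I_d),
  (forall k, 0 < t k) -> Un_cv t 0 -> vcv v v0 -> (forall k, K (l k)) ->
  exists y : nat -> Vec 'I_n, eventually (fun k =>
    K (G (vadd zbar (vscale (t k) (vpair (vfst (v k)) (y k))))) /\
    t k * norm (vsub (y k) (vsnd (v k))) <=
      kappa * norm (vsub (G (vadd zbar (vscale (t k) (v k)))) (l k)) + t k * t k * t k).
Proof.
have [kappa [dW [dU [k0 [dW0 [dU0 hRS]]]]]] := RS.
exists kappa; split=> // t v v0 l t0 ct cv Kl.
have dd0 : 0 < Rmin dW dU by apply: Rmin_glb_lt.
have ok := near_zbar dd0 ct cv.
have ex k : exists y, norm (vsub (vadd zbar (vscale (t k) (v k))) zbar) < Rmin dW dU ->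
    K (G (vadd zbar (vscale (t k) (vpair (vfst (v k)) y)))) /\
    t k * norm (vsub y (vsnd (v k))) <=
      kappa * norm (vsub (G (vadd zbar (vscale (t k) (v k)))) (l k)) + t k * t k * t k.
  case: (classic (norm (vsub (vadd zbar (vscale (t k) (v k))) zbar) < Rmin dW dU)) => [h|no];
    last by exists vzero.
  have tk := t0 k.
  have ez : vadd zbar (vscale (t k) (v k)) =
      vpair (vadd pbar (vscale (t k) (vfst (v k)))) (vadd xbar (vscale (t k) (vsnd (v k)))).
    by rewrite [v k in LHS]vpair_eta zbar_shift.
  rewrite ez vpairB in h.
  have hW := norm_vpair_l (vsub (vadd pbar (vscale (t k) (vfst (v k)))) pbar)
    (vsub (vadd xbar (vscale (t k) (vsnd (v k)))) xbar).
  have hU := norm_vpair_r (vsub (vadd pbar (vscale (t k) (vfst (v k)))) pbar)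
    (vsub (vadd xbar (vscale (t k) (vsnd (v k)))) xbar).
  have mW := Rmin_l dW dU; have mU := Rmin_r dW dU.
  have t3 : 0 < t k * t k * t k by do !apply: Rmult_lt_0_compat.
  have [x' [Kx' hx']] := hRS _ _ (Rle_lt_trans _ _ _ hW (Rlt_le_trans _ _ _ h mW))
    (Rle_lt_trans _ _ _ hU (Rlt_le_trans _ _ _ h mU)) _ (Kl k) _ t3.
  exists (vscale (/ t k) (vsub x' xbar)) => _; rewrite zbar_shift.
  have -> : vadd xbar (vscale (t k) (vscale (/ t k) (vsub x' xbar))) = x'.
    by apply: functional_extensionality => i; rewrite /vadd /vsub /vscale; field; lra.
  split=> //; rewrite ez; apply: Rlt_le; apply: Rle_lt_trans hx'; apply: Req_le.
  have tE (b : Vec 'I_n) : t k * norm b = norm (vscale (t k) b) by rewrite normZ Rabs_pos_eq; vlra.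
  rewrite tE norm_subC; congr norm.
  by apply: functional_extensionality => i; rewrite /vadd /vsub /vscale; field; lra.
have [y hy] := choice_seq ex.
by exists y; apply: eventually_mono ok => k /hy.
Qed.

(** Along [zbar + t w] the value of [G] is [o(t)]-close to [t A w], a point of [K]; the corrector
    then shifts [x] by [o(t)], which leaves the direction [w] unchanged in the limit. *)
Lemma linearized_tangent_cone w : K (mapply A w) -> tangent_cone Omega zbar w.
Proof.
move=> Kw; have [kappa [k0 hc]] := robinson_corrector.
have t0 := small_gt0.
have [|y ev] := hc small (fun _ => w) w (fun k => vscale (small k) (mapply A w)) t0 cv_small (vcv_const w).
  by move=> k; case: (cnK) => _; apply=> //; apply: Rlt_le.
have cq := G_quotient t0 cv_small (vcv_const w).
pose r k := vsub (vscale (/ small k) (G (vadd zbar (vscale (small k) w)))) (mapply A w).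
have cr : vcv r vzero.
  have := vcvB cq (vcv_const (mapply A w)).
  by have -> : vsub (mapply A w) (mapply A w) = vzero by vring.
have cy : vcv y (vsnd w).
  apply: (vcv_squeezeR (e := fun k => kappa * norm (r k) + small k * small k)).
    apply: eventually_mono ev => k [_ h]; have tk := t0 k.
    apply: (Rmult_le_reg_l (small k)) => //; apply: (Rle_trans _ _ _ h); apply: Req_le.
    have tE (b : Vec 'I_d) : small k * norm b = norm (vscale (small k) b)
      by rewrite normZ Rabs_pos_eq; vlra.
    have -> : vsub (G (vadd zbar (vscale (small k) w))) (vscale (small k) (mapply A w)) =
        vscale (small k) (r k).
      by apply: functional_extensionality => i; rewrite /r /vadd /vsub /vscale; field; lra.
    rewrite -tE; ring.
  have := CV_plus _ _ _ _ (cvZ kappa (cv_norm cr)) (CV_mult _ _ _ _ cv_small cv_small).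
  by rewrite norm0 !Rmult_0_r Rplus_0_r.
have cw : vcv (fun k => vpair (vfst w) (y k)) w.
  by rewrite [w in vcv _ w]vpair_eta; apply: vcv_vpair => //; exact: vcv_const.
apply: (tangent_coneI t0 cv_small cw).
apply: eventually_mono (eventually_and ev (near_zbar de0 cv_small cw)) => k [[Kk _] hk].
by apply/GO.
Qed.

Lemma tangent_coneE w : tangent_cone Omega zbar w <-> K (mapply A w).
Proof. by split; [exact: tangent_cone_linearized|exact: linearized_tangent_cone]. Qed.

(** With [A_p q = A_x a + k] and [k] in [lin K], every polar [mu] vanishes at [k]. The vector [a] is
    chosen before [mu], which lets different multipliers of [xs] be compared. *)
Lemma char_subspace_inner q : char_subspace K A q -> exists a, forall u mu xs,
  polar K mu -> tapply (grad_x A) mu = xs -> inner mu (mapply A (vpair q u)) = inner xs (vadd a u).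
Proof.
move=> [a [k [lk e]]]; exists a => u mu xs pm em.
have E : mapply (grad_p A) q = vadd (mapply (grad_x A) a) k by apply: functional_extensionality.
by rewrite mapply_vpair E -em inner_tapply mapplyD !innerDr (polar_lin pm lk); ring.
Qed.

(** [gphPsi] written for an abstract [Omega]; the two are convertible when [Omega] is
    [gphGamma C g]. *)
Definition normal_graph (w : Vec (ZI m n + 'I_n)%type) : Prop :=
  reg_normal (fun x => Omega (vpair (vfst (vfst w)) x)) (vsnd (vfst w)) (vsnd w).

Lemma normal_graph_shift s v w xs : normal_graph (vadd (vpair zbar xs) (vscale s (vpair v w))) =
  reg_normal (fun x => Omega (vpair (vadd pbar (vscale s (vfst v))) x))
    (vadd xbar (vscale s (vsnd v))) (vadd xs (vscale s w)).
Proof. by []. Qed.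

Lemma linearized_add w w' : lin K (mapply A w) -> K (mapply A w') -> K (mapply A (vadd w w')).
Proof. by move=> [kw _] kw'; rewrite mapplyD; exact: cone_add. Qed.

(** * Strict complementarity and the two inclusions *)

Context (xs : Vec 'I_n) (mub : Vec 'I_d) (ri : rel_interior (polar K) mub)
  (emub : tapply (grad_x A) mub = xs).

Lemma strict_compl_lin q u mu : char_subspace K A q -> polar K mu -> tapply (grad_x A) mu = xs ->
  K (mapply A (vpair q u)) -> inner mu (mapply A (vpair q u)) = 0 -> lin K (mapply A (vpair q u)).
Proof.
move=> /char_subspace_inner [a ha] pm em Kv e0.
apply: (ri_polar_lin clK cvK cnK ri Kv).
by rewrite (ha u mub xs ri.1 emub) -(ha u mu xs pm em).
Qed.

Definition derivative_formula (v : Vec (ZI m n)) (w : Vec 'I_n) : Prop :=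
  exists (zs : Vec (ZI m n)) (mu : Vec 'I_d) (ys : Vec (ZI m n)),
    [/\ reg_normal (tangent_cone Omega zbar) v zs, vsnd zs = xs, polar K mu /\ tapply A mu = zs,
     reg_normal (crit_cone Omega zbar zs) v ys & w = vadd (hess_x_mult T mu v) (vsnd ys)].

Lemma derivative_subset q u w : char_subspace K A q ->
  tangent_cone normal_graph (vpair zbar xs) (vpair (vpair q u) w) ->
  derivative_formula (vpair q u) w.
Proof.
move=> cq /tangent_cone_mem [t [W [t0 ct cW hW]]].
set v := vpair q u in cW *.
pose vk k := vfst (W k); pose wk k := vsnd (W k).
have cv : vcv vk v by move=> i; exact: (cW (inl i)).
have cw : vcv wk w by move=> i; exact: (cW (inr i)).
have {}hW k : reg_normal (fun x => Omega (vpair (vadd pbar (vscale (t k) (vfst (vk k)))) x))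
    (vadd xbar (vscale (t k) (vsnd (vk k)))) (vadd xs (vscale (t k) (wk k))).
  by rewrite -normal_graph_shift; have := hW k; rewrite [W k]vpair_eta.
have ez k : vadd zbar (vscale (t k) (vk k)) =
    vpair (vadd pbar (vscale (t k) (vfst (vk k)))) (vadd xbar (vscale (t k) (vsnd (vk k)))).
  by rewrite [vk k in LHS]vpair_eta zbar_shift.
have Oz k : Omega (vadd zbar (vscale (t k) (vk k))) by rewrite ez; case: (hW k).
have [rho [kappa [rho0 [k0 hm]]]] := normal_multiplier.
have cxs : vcv (fun k => vadd xs (vscale (t k) (wk k))) xs.
  have := vcvD (vcv_const xs) (vcv_null ct cw).
  by have -> : vadd xs vzero = xs by vring.
have [B hB] := vcv_bounded cxs.
pose z k := vadd zbar (vscale (t k) (vk k)).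
have okr := near_zbar rho0 ct cv.
(* Away from the neighborhood the multiplier defaults to 0, so that the bound holds for every [k],
   as [BW_seq] demands. *)
have exm k : exists mu, norm mu <= kappa * B /\ (norm (vsub (z k) zbar) < rho ->
    [/\ polar K mu, inner mu (G (z k)) = 0 &
     tapply (grad_x (DG (z k))) mu = vadd xs (vscale (t k) (wk k))]).
  have hBk := hB k.
  have xk0 := norm_ge0 (vadd xs (vscale (t k) (wk k))).
  case: (classic (norm (vsub (z k) zbar) < rho)) => [h|no]; last first.
    exists vzero; split=> //; rewrite norm0; apply: Rmult_le_pos => //; vlra.
  rewrite /z ez in h.
  have := Oz k; rewrite ez => Ok.
  have [mu [h1 h2 h3 h4]] := hm _ _ _ h Ok (hW k).
  exists mu; split; last by move=> _; rewrite /z ez.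
  by apply: (Rle_trans _ _ _ h3); apply: Rmult_le_compat_l.
have [muk hmu] := choice_seq exm.
have [|mu [phi [hp cm]]] := @BW_seq _ muk (kappa * B); first by move=> k; case: (hmu k).
have ok := eventually_subseq hp okr.
have t0' k : 0 < t (phi k) by [].
have ct' := cv_subseq hp ct.
have cv' := vcv_subseq hp cv.
have cw' := vcv_subseq hp cw.
have pm : polar K mu.
  apply: closed_vcv (@closed_polar _ K) cm _.
  by apply: eventually_mono ok => k /(hmu (phi k)).2 [].
have Tv : tangent_cone Omega zbar v.
  by apply: (tangent_coneI t0 ct cv); exists O.
have Kv := tangent_cone_linearized Tv.
(* The complementarity [<mu_k, G(z_k)> = 0] is divided by [t_k]; as [G zbar = 0], these values are
   difference quotients. *)
have e0 : inner mu (mapply A v) = 0.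
  apply: UL_sequence (cv_inner cm (G_quotient t0' ct' cv')) _.
  have [N hN] := ok; apply: (cv_squeeze (v := fun _ => 0)); last exact: cv_const.
  exists N => k /hN /(hmu (phi k)).2 [_ e _].
  by rewrite innerZr -/(z (phi k)) e Rmult_0_r Rminus_0_r Rabs_R0; lra.
pose X k : Mat 'I_d 'I_n := fun e j =>
  / t (phi k) * (DG (z (phi k)) e (inr j) - A e (inr j)).
have [B' hB'] := vcv_bounded cv'.
have cX e j : Un_cv (fun k => X k e j) (grad_x (dmat T v) e j).
  have h := jacobian_seq G2 t0' ct' hB' e (inr j).
  have hd : Un_cv (fun k => dmat T (vk (phi k)) e (inr j)) (dmat T v e (inr j)).
    exact: (vcv_mapplyc (ten2mat T) cv' (e, inr j)).
  have := CV_plus _ _ _ _ h hd; rewrite Rplus_0_l.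
  by apply: cv_ext => k; rewrite /X /A /z; unfold reverse_coercion; ring.
have em : tapply (grad_x A) mu = xs.
  have c1 : vcv (fun k => tapply (grad_x (DG (z (phi k)))) (muk (phi k))) (tapply (grad_x A) mu).
    apply: vcv_tapply => // e j.
    have := CV_plus _ _ _ _ (CV_mult _ _ _ _ ct' (cX e j)) (cv_const (A e (inr j))).
    rewrite Rmult_0_l Rplus_0_l; apply: cv_ext => k; have := t0' k => tk.
    by rewrite /X /grad_x; field; lra.
  apply: vcv_unique c1 _; apply: (vcv_squeeze (v := fun k => vscale (t (phi k)) (wk (phi k)))).
    apply: eventually_mono ok => k /(hmu (phi k)).2 [_ _ ->].
    have -> : vsub (vadd xs (vscale (t (phi k)) (wk (phi k)))) xs = vscale (t (phi k)) (wk (phi k)).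
      by vring.
    exact: Rle_refl.
  exact: vcv_null ct' cw'.
have lv : lin K (mapply A v) := strict_compl_lin cq pm em Kv e0.
have sub := subspace_tapply (grad_x A) (ri_polar_subspace cnK ri).
have comega : vcv (fun k => vsub (wk (phi k)) (tapply (X k) (muk (phi k))))
    (vsub w (hess_x_mult T mu v)).
  by apply: vcvB cw' _; rewrite hess_x_multE; apply: vcv_tapply.
(* From [xs + t_k w_k = A_x^* mu_k + t_k X_k^* mu_k] and [xs = A_x^* mub], the left-hand side is the
   image of [(mu_k - mub)/t_k]. *)
have evW : eventually (fun k => exists2 eta,
    exists nu c, polar K nu /\ 0 <= c /\ eta = vsub nu (vscale c mub) &
    vsub (wk (phi k)) (tapply (X k) (muk (phi k))) = tapply (grad_x A) eta).
  apply: eventually_mono ok => k /(hmu (phi k)).2 [pk _ ek].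
  have tk := t0' k; have it : 0 < / t (phi k) by exact: Rinv_0_lt_compat.
  exists (vsub (vscale (/ t (phi k)) (muk (phi k))) (vscale (/ t (phi k)) mub)).
    exists (vscale (/ t (phi k)) (muk (phi k))), (/ t (phi k)).
    by split; [apply: polar_scale => //; lra|split; [lra|]].
  rewrite tapplyB !tapplyZ emub.
  have -> : tapply (X k) (muk (phi k)) = vscale (/ t (phi k))
      (vsub (tapply (grad_x (DG (z (phi k)))) (muk (phi k))) (tapply (grad_x A) (muk (phi k)))).
    apply: functional_extensionality => j.
    rewrite vsubE /vscale /vadd /tapply -!vsumZ -vsumD -vsumZ.
    by apply: eq_vsum => e; rewrite /X /grad_x; ring.
  by rewrite ek; apply: functional_extensionality => j; rewrite /vsub /vscale /vadd; field; lra.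
have [_ [nu [c [pn [c0 ->]]]] eom] := closed_vcv (closed_subspace sub) comega evW.
(* Replacing [mub] by [mu] keeps the image under [A_x^*]. On the critical cone of [A^* mu] the term
   with [mu] vanishes, and [<nu, A v> = 0] because [A v] lies in [lin K], so only [<nu, A y> <= 0]
   remains. *)
exists (tapply A mu), mu, (tapply A (vsub nu (vscale c mu))); split=> //.
- apply: reg_normalI => // y /tangent_cone_linearized Ky.
  by rewrite inner_tapply mapplyB innerBr e0; have := pm _ Ky; vlra.
- apply: reg_normalI; first by split=> //; rewrite inner_tapply.
  move=> y [/tangent_cone_linearized Ky]; rewrite inner_tapply => ey.
  rewrite inner_tapply mapplyB innerBr !(innerBl, innerZl) ey e0 (polar_lin pn lv).
  by have := pn _ Ky; vlra.
- have -> : vsnd (tapply A (vsub nu (vscale c mu))) = vsub w (hess_x_mult T mu v).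
    by rewrite vsnd_tapply eom !tapplyB !tapplyZ em emub.
  by vring.
Qed.

Lemma derivative_superset q u w : char_subspace K A q ->
  in_rge_plus_lin A K (hess_vv T (vpair q u)) ->
  derivative_formula (vpair q u) w ->
  tangent_cone normal_graph (vpair zbar xs) (vpair (vpair q u) w).
Proof.
move=> cq [a' [k [lk eh]]] [zs [mu [ys [hzs ezs [pm emz] hys ew]]]].
set v := vpair q u in eh hzs hys ew *.
have em : tapply (grad_x A) mu = xs by rewrite -vsnd_tapply emz.
have Kv : K (mapply A v) by apply: tangent_cone_linearized; case: hzs.
have sc := cnK.2.
have ezv : inner zs v = 0.
  have h1 := reg_normal_dir hzs (d := v) ltac:(move=> s s0; apply/tangent_coneE;
    have -> : vadd v (vscale s v) = vscale (1 + s) v by [vring]; rewrite mapplyZ; apply: sc => //; lra).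
  have h2 := reg_normal_dir hzs (d := vopp v) ltac:(move=> s s0; apply/tangent_coneE;
    have -> : vadd v (vscale s (vopp v)) = vscale (1 - s) v by [vring];
    rewrite mapplyZ; apply: sc => //; lra).
  by rewrite innerNr in h2; vlra.
have e0 : inner mu (mapply A v) = 0 by rewrite -inner_tapply emz.
have lv : lin K (mapply A v) := strict_compl_lin cq pm em Kv e0.
(* Moving from [v] along [(0, y)] stays in the critical cone, since [mu] vanishes on [lin K]. This
   sign is what finally excludes a nonzero cluster point. *)
have hys0 y : lin K (mapply A (vpair vzero y)) -> inner (vsnd ys) y <= 0.
  move=> ly; rewrite -inner_vpair0; apply: (reg_normal_dir hys) => s s0; split.
    apply/tangent_coneE; apply: linearized_add => //; rewrite mapplyZ; apply: sc; [by case: ly|lra].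
  by rewrite innerDr ezv innerZr -emz inner_tapply (polar_lin pm ly); ring.

(* The parabolic arc and its feasible corrector *)
pose a := vscale (- / 2) a'.
pose t := small.
have t0 : forall j, 0 < t j := small_gt0.
have ct : Un_cv t 0 := cv_small.
pose vk j := vadd v (vscale (t j) a).
have cv : vcv vk v.
  have := vcvD (vcv_const v) (vcv_null ct (vcv_const a)).
  by have -> : vadd v vzero = v by vring.
pose l j := vadd (vscale (t j) (mapply A v)) (vscale (t j * t j / 2) k).
have ll j : lin K (l j).
  by have tj := t0 j; apply: lin_add => //; apply: lin_scale => //; nra.
pose z j := vadd zbar (vscale (t j) (vk j)).
pose r j := vscale (/ (t j * t j)) (vsub (G (z j)) (l j)).
have cr : vcv r vzero.
  have h := vcvD (taylor2_seq de0 G1 G2 t0 ct cv) (vcv_const (vsub (mapply A a) (vscale (/2) k))).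
  (* With [T(v,v) = A a' + k], the factor [- 1/2] in [a] cancels the range part of the Taylor term;
     the rest, [k/2], is put into [l]. *)
  have eq0 : vadd (vscale (/ 2) (mapply (dmat T v) v)) (vsub (mapply A a) (vscale (/ 2) k)) = vzero.
    rewrite -hess_vvE /a mapplyZ; apply: functional_extensionality => e.
    rewrite /vadd /vscale /vsub /vzero eh; lra.
  rewrite eq0 in h; apply: vcv_ext h => j; have tj := t0 j.
  rewrite /r G0 /l -/A -/(z j) /vk mapplyD mapplyZ.
  apply: functional_extensionality => e; rewrite /vadd /vscale /vsub /vzero.
  by unfold reverse_coercion; field; lra.
have Gz j : G (z j) = vadd (l j) (vscale (t j * t j) (r j)).
  by have tj := t0 j; apply: functional_extensionality => e; rewrite /r /vadd /vscale /vsub; field; lra.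
have Gmu j : inner mu (G (z j)) = t j * t j * inner mu (r j).
  by rewrite Gz innerDr (polar_lin pm (ll j)) innerZr Rplus_0_l.
have [kappa [k0 hc]] := robinson_corrector.
have [yt evc] := hc t vk v l t0 ct cv (fun j => (ll j).1).
(* The corrector moves [x] by [t^2 Dt], which is [o(t^2)]. This order is needed because the
   projection weighs [<xs, .>] by [1/t]. *)
pose Dt j := vscale (/ t j) (vsub (yt j) (vsnd (vk j))).
have cD : vcv Dt vzero.
  apply: (vcv_squeezeR (e := fun j => kappa * norm (r j) + t j)).
    apply: eventually_mono evc => j [_ h]; have tj := t0 j.
    have -> : vsub (Dt j) vzero = Dt j by vring.
    rewrite /Dt normZ Rabs_pos_eq; last by apply: Rlt_le; apply: Rinv_0_lt_compat.
    apply: (Rmult_le_reg_l (t j * t j)); first nra.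
    have -> : t j * t j * (/ t j * norm (vsub (yt j) (vsnd (vk j)))) =
       t j * norm (vsub (yt j) (vsnd (vk j))) by field; lra.
    apply: (Rle_trans _ _ _ h); apply: Req_le; rewrite -/(z j) Gz.
    have -> : vsub (vadd (l j) (vscale (t j * t j) (r j))) (l j) = vscale (t j * t j) (r j) by vring.
    by rewrite normZ Rabs_pos_eq; [unfold reverse_coercion; ring|nra].
  by have := CV_plus _ _ _ _ (cvZ kappa (cv_norm cr)) ct; rewrite norm0 Rmult_0_r Rplus_0_r.

(* Projection of the shifted arc *)
pose M := norm mu * norm (mat2vec (ten2mat T)).
have M0 : 0 <= M by apply: Rmult_le_pos; exact: norm_ge0.
(* [M] bounds [<mu, T(y,y)>] by [M |y|^2], which enters the limit inequality with a factor 2; any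
   [rho > 2 M] would do. *)
pose rho := 2 * M + 1.
have rho0 : 0 < rho by rewrite /rho; lra.
pose pt j y := vadd zbar (vscale (t j) (vadd (vk j) (vpair vzero y))).
(* The shift [(xs + t w)/rho] in units of [t], so that the nearest point [y] carries the normal
   [rho t (b - y) = xs + t (w - rho y)]. *)
pose b j := vscale (/ (rho * t j)) (vadd xs (vscale (t j) w)).
pose dt j := vscale (t j) (Dt j).
pose ok j := (forall y, norm y <= 1 -> norm (vsub (pt j y) zbar) < de) /\ norm (dt j) <= 1 /\
   K (G (pt j (dt j))).
have evok : eventually ok.
  have [B hB] := vcv_bounded cv.
  have B0 : 0 <= B by apply: Rle_trans (hB O); exact: norm_ge0.
  have c1 : Un_cv (fun j => t j * (B + 1)) 0.
    by rewrite -(Rmult_0_l (B + 1)); apply: CV_mult => //; exact: cv_const.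
  have c2 := cv_norm (vcv_null ct cD); rewrite norm0 in c2.
  have ev1 := cv_eventually_lt c1 de0.
  have ev2 := cv_eventually_lt c2 Rlt_0_1.
  apply: eventually_mono (eventually_and evc (eventually_and ev1 ev2)) => j [[h1 _] [h2 h3]].
  have tj := t0 j; split; [move=> y y1|split; first by rewrite /dt; lra].
    have -> : vsub (pt j y) zbar = vscale (t j) (vadd (vk j) (vpair vzero y)) by rewrite /pt; vring.
    rewrite normZ Rabs_pos_eq; last lra.
    apply: Rle_lt_trans h2; apply: Rmult_le_compat_l; first lra.
    apply: (Rle_trans _ _ _ (norm_triangle _ _)); rewrite norm_vpair0.
    by apply: Rplus_le_compat.
  suff <- : vadd zbar (vscale (t j) (vpair (vfst (vk j)) (yt j))) = pt j (dt j) by [].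
  rewrite /pt /dt /Dt; congr (vadd _ (vscale _ _)).
  apply: functional_extensionality => -[i|i]; have tj0 := t0 j;
    rewrite /vadd /vpair /vfst /vsnd /vscale /vsub /vzero; unfold reverse_coercion; [ring|field; lra].
have exy j : exists y, norm y <= 1 /\ (ok j -> K (G (pt j y)) /\
    forall y', norm y' <= 1 -> K (G (pt j y')) -> norm (vsub (b j) y) <= norm (vsub (b j) y')).
  case: (classic (ok j)) => [[o1 [o2 o3]]|no]; last by exists vzero; split; [rewrite norm0; lra|].
  (* The unit ball keeps the points where [G] is differentiable, hence continuous, so the feasible
     set is closed. The ball constraint becomes inactive once [y] tends to 0. *)
  have cl : is_closed (fun y => norm (vsub y vzero) <= 1 /\ K (G (pt j y))).
    move=> x hx.
    have [yy hyy] := choice_seq (fun i => hx _ (small_gt0 i)).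
    have cyy : vcv yy x.
      apply: vcv_squeezeR cv_small; exists O => i _; case: (hyy i) => _; exact: Rlt_le.
    have x1 : norm (vsub x vzero) <= 1.
      by apply: closed_vcv (@is_closed_ball _ vzero 1) cyy _; exists O => i _; case: (hyy i) => -[].
    split=> //.
    have dG : fderiv G (pt j x) (DG (pt j x)).
      by apply: G1; apply: o1; move: x1; have -> : vsub x vzero = x by vring.
    have cpt : vcv (fun i => pt j (yy i)) (pt j x).
      apply: vcvD (vcv_const _) _; apply: vcvZ; first exact: cv_const.
      by apply: vcvD (vcv_const _) _; apply: vcv_vpair => //; exact: vcv_const.
    by apply: closed_vcv clK (fderiv_cv dG cpt) _; exists O => i _; case: (hyy i) => -[].
  have e y : vsub y (@vzero 'I_n) = y by vring.
  have [|y [[y1 y2] y3]] := nearest_point (b j) cl; first by exists (dt j); rewrite e.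
  rewrite e in y1; exists y; split=> // _; split=> // y' y'1 y'2.
  by apply: y3; rewrite e.
have [y hy] := choice_seq exy.
have ydir j : vadd (z j) (vscale (t j) (vpair vzero (y j))) = pt j (y j) by rewrite /pt /z; vring.

(* A cluster point of the displacements *)
have exs j : exists s, 0 <= s <= 1 /\ (ok j ->
   inner mu (vsub (G (pt j (y j))) (G (z j))) =
   inner mu (mapply (DG (pt j (vscale s (y j)))) (vscale (t j) (vpair vzero (y j))))).
  case: (classic (ok j)) => [[o1 _]|no]; last by exists 0; split; [lra|].
  have E s : vadd (z j) (vscale s (vscale (t j) (vpair vzero (y j)))) = pt j (vscale s (y j)).
    rewrite /pt /z; have -> : vpair (@vzero 'I_m) (vscale s (y j)) = vscale s (vpair vzero (y j)).
      by rewrite vpairZ; congr vpair; vring.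
    vring.
  have [|s [s01 hs]] := @MVT_inner _ _ G DG (z j) (vscale (t j) (vpair vzero (y j))) mu.
    move=> s s01; rewrite E; apply: G1; apply: o1; rewrite normZ Rabs_pos_eq; last lra.
    by have [y1 _] := hy j; have := norm_ge0 (y j); vnra.
  by exists s; split=> // _; rewrite E ydir in hs.
have [s hs] := choice_seq exs.
(* The intermediate parameter is packed with [y] as a one-dimensional vector to extract a common
   subsequence. *)
have [j|lim [phi [hp clim]]] := @BW_seq _ (fun j => vpair (fun _ : 'I_1 => s j) (y j)) 2.
  apply: (Rle_trans _ _ _ (norm_vpair_le _ _)).
  have [y1 _] := hy j; have [s01 _] := hs j.
  have : norm (fun _ : 'I_1 => s j) <= 1.
    by apply: norm_le_of_sqr; [lra|rewrite /inner /vsum big_ord1; nra].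
  vlra.
pose s0 := lim (inl ord0); pose y0 := vsnd lim.
have cs : Un_cv (fun j => s (phi j)) s0 := clim (inl ord0).
have cy : vcv (fun j => y (phi j)) y0 by move=> i; exact: clim (inr i).
have s01 : 0 <= s0 <= 1.
  split; [apply: cv_le (cv_const 0) cs _|apply: cv_le cs (cv_const 1) _];
    by exists O => j _; case: (hs (phi j)); lra.
have t0' j : 0 < t (phi j) by [].
have ct' := cv_subseq hp ct.
have cv' := vcv_subseq hp cv.
have cr' := vcv_subseq hp cr.
have cD' := vcv_subseq hp cD.
have evok' := eventually_subseq hp evok.
pose v' j := vadd (vk (phi j)) (vpair vzero (vscale (s (phi j)) (y (phi j)))).
have e0s c x : vpair (@vzero 'I_m) (vscale c x) = vscale c (vpair (@vzero 'I_m) (x : Vec 'I_n)).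
  by rewrite vpairZ; congr vpair; vring.
have cv'' : vcv v' (vadd v (vscale s0 (vpair vzero y0))).
  rewrite -e0s; apply: vcvD cv' _; apply: vcv_vpair; [exact: vcv_const|exact: vcvZ].
pose X j : Mat 'I_d (ZI m n) := fun e i =>
  / t (phi j) * (DG (pt (phi j) (vscale (s (phi j)) (y (phi j)))) e i - A e i) - dmat T (v' j) e i.
have [B hB] := vcv_bounded cv''.
have cX e i : Un_cv (fun j => X j e i) ((fun _ _ => 0) e i).
  exact: jacobian_seq G2 t0' ct' hB e i.
have cy2 : vcv (fun j => vpair (@vzero 'I_m) (y (phi j))) (vpair vzero y0).
  by apply: vcv_vpair => //; exact: vcv_const.
(* The value at the corrector [dt] of the objective [rho |y|^2 - 2 <xs, y>/t - 2 <w, y>] minimized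
   by [y]. *)
pose ga j := rho * (t j * t j * inner (Dt j) (Dt j)) - 2 * (inner xs (Dt j) + t j * inner w (Dt j)).
have cga : Un_cv (fun j => ga (phi j)) 0.
  have -> : 0 = rho * (0 * 0 * inner (@vzero 'I_n) vzero) - 2 * (inner xs vzero + 0 * inner w vzero).
    by rewrite !inner0r; ring.
  apply: CV_minus; apply: cvZ.
    by apply: CV_mult; [exact: CV_mult|exact: cv_inner].
  apply: CV_plus; first exact: cv_inner (vcv_const _) cD'.
  by apply: CV_mult => //; exact: cv_inner (vcv_const _) cD'.
(* Optimality of [y], compared with the corrector [dt] supplied by Robinson stability. *)
have I1 : eventually (fun j => rho * inner (y (phi j)) (y (phi j)) <=
    2 * (inner xs (y (phi j)) / t (phi j)) + 2 * inner w (y (phi j)) + ga (phi j)).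
  apply: eventually_mono evok' => j'; set j := phi j' => oj; have tj := t0 j.
  have [_ /(_ oj) [_ hmin]] := hy j.
  have := hmin (dt j) oj.2.1 oj.2.2 => hn.
  have h2 : inner (vsub (b j) (y j)) (vsub (b j) (y j)) <= inner (vsub (b j) (dt j)) (vsub (b j) (dt j)).
    rewrite -!norm_sqr; have := norm_ge0 (vsub (b j) (y j)); vnra.
  rewrite !(innerBl, innerBr) (innerC (y j) (b j)) (innerC (dt j) (b j)) in h2.
  have {h2} h3 : rho * (inner (y j) (y j) - 2 * inner (b j) (y j)) <=
      rho * (inner (dt j) (dt j) - 2 * inner (b j) (dt j)).
    by apply: Rmult_le_compat_l; vlra.
  have E1 x : rho * (2 * inner (b j) x) = 2 * (inner xs x / t j) + 2 * inner w x.
    by rewrite /b innerZl innerDl innerZl; field; lra.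
  have E2 : rho * (inner (dt j) (dt j) - 2 * inner (b j) (dt j)) = ga j.
    by rewrite /ga /dt /b !(innerZl, innerZr, innerDl); field; lra.
  rewrite E2 Rmult_minus_distr_l E1 in h3; vlra.
(* Feasibility gives [<mu, G> <= 0], expanded around the arc by the mean value theorem. *)
have I2 : eventually (fun j => inner xs (y (phi j)) / t (phi j) <=
    - inner mu (r (phi j)) - inner mu (mapply (X j) (vpair vzero (y (phi j))))
    - inner mu (mapply (dmat T (v' j)) (vpair vzero (y (phi j))))).
  apply: eventually_mono evok' => j' oj; have tj := t0' j'.
  have [_ /(_ oj) [Ky _]] := hy (phi j').
  have [_ /(_ oj) hmv] := hs (phi j').
  have hneg := pm _ Ky.
  have eDG : mapply (DG (pt (phi j') (vscale (s (phi j')) (y (phi j'))))) (vpair vzero (y (phi j'))) =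
     vadd (mapply A (vpair vzero (y (phi j')))) (vscale (t (phi j'))
       (vadd (mapply (X j') (vpair vzero (y (phi j')))) (mapply (dmat T (v' j')) (vpair vzero (y (phi j')))))).
    rewrite /X; move: (vscale (s (phi j')) (y (phi j'))) => sy.
    apply: functional_extensionality => e; rewrite /vadd /vscale /mapply -!vsumD -vsumZ -vsumD.
    by apply: eq_vsum => i; unfold reverse_coercion; field; lra.
  rewrite mapplyZ innerZr eDG innerBr Gmu innerDr innerZr innerDr in hmv.
  have exs' : inner mu (mapply A (vpair vzero (y (phi j')))) = inner xs (y (phi j')).
    by rewrite -mapply_grad_x -inner_tapply em.
  rewrite exs' in hmv.
  apply: (Rmult_le_reg_l (t (phi j') * t (phi j'))); first nra.
  have -> : t (phi j') * t (phi j') * (inner xs (y (phi j')) / t (phi j')) =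
     t (phi j') * inner xs (y (phi j')) by field; lra.
  vlra.
have cRHS : Un_cv (fun j => 2 * (- inner mu (r (phi j)) - inner mu (mapply (X j) (vpair vzero (y (phi j))))
    - inner mu (mapply (dmat T (v' j)) (vpair vzero (y (phi j))))) + 2 * inner w (y (phi j)) + ga (phi j))
  (2 * (- inner mu vzero - inner mu (mapply (fun (_ : 'I_d) (_ : ZI m n) => 0) (vpair vzero y0))
    - inner mu (mapply (dmat T (vadd v (vscale s0 (vpair vzero y0)))) (vpair vzero y0)))
    + 2 * inner w y0 + 0).
  have c1 := cv_inner (vcv_const mu) cr'.
  have c2 := cv_inner (vcv_const mu) (vcv_mapply cX cy2).
  have cT e i : Un_cv (fun j => dmat T (v' j) e i) (dmat T (vadd v (vscale s0 (vpair vzero y0))) e i).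
    exact: (vcv_mapplyc (ten2mat T) cv'' (e, i)).
  have c3 := cv_inner (vcv_const mu) (vcv_mapply cT cy2).
  have c4 := cv_inner (vcv_const w) cy.
  exact: (CV_plus _ _ _ _ (CV_plus _ _ _ _ (cvZ 2 (CV_minus _ _ _ _ (CV_minus _ _ _ _ (CV_opp _ _ c1) c2) c3))
    (cvZ 2 c4)) cga).
have evlim : eventually (fun j => rho * inner (y (phi j)) (y (phi j)) <=
    2 * (- inner mu (r (phi j)) - inner mu (mapply (X j) (vpair vzero (y (phi j))))
    - inner mu (mapply (dmat T (v' j)) (vpair vzero (y (phi j))))) + 2 * inner w (y (phi j)) + ga (phi j)).
  by apply: eventually_mono (eventually_and I1 I2) => j [h1 h2]; vlra.
have hlim := cv_le (cvZ rho (cv_inner cy cy)) cRHS evlim.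
have mapply0 x : mapply (fun (_ : 'I_d) (_ : ZI m n) => 0) x = vzero.
  apply: functional_extensionality => e; rewrite /mapply -[RHS](@vsum0 (ZI m n)).
  by apply: eq_vsum => i; ring.
have ehess x : inner (hess_x_mult T mu v) x = inner mu (mapply (dmat T v) (vpair vzero x)).
  by rewrite hess_x_multE inner_tapply mapply_grad_x.
(* The Hessian part of [w] cancels [<mu, T(v, y0)>], leaving the critical normal [ys] and a
   quadratic term in [y0]. *)
have hlim2 : rho * inner y0 y0 <= 2 * inner (vsnd ys) y0
    - 2 * s0 * inner mu (mapply (dmat T (vpair vzero y0)) (vpair vzero y0)).
  move: hlim; rewrite mapply0 !inner0r inner_dmatD -ehess ew innerDl; vlra.
have bM : Rabs (inner mu (mapply (dmat T (vpair vzero y0)) (vpair vzero y0))) <= M * inner y0 y0.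
  have h1 := Cauchy_Schwarz_abs mu (mapply (dmat T (vpair vzero y0)) (vpair vzero y0)).
  have h2 := norm_mapply (dmat T (vpair vzero y0)) (vpair vzero y0).
  have h3 := norm_dmat T (vpair vzero y0).
  rewrite norm_vpair0 in h2 h3.
  apply: (Rle_trans _ _ _ h1); rewrite /M Rmult_assoc; apply: Rmult_le_compat_l; first exact: norm_ge0.
  apply: (Rle_trans _ _ _ h2); rewrite -norm_sqr -Rmult_assoc; apply: Rmult_le_compat_r => //.
  exact: norm_ge0.
have cvy : vcv (fun j => vadd (vk (phi j)) (vpair vzero (y (phi j)))) (vadd v (vpair vzero y0)).
  exact: vcvD cv' cy2.
have KAy : K (mapply A (vpair vzero y0)).
  apply: (lin_cone_sub cvK cnK _ lv); rewrite -mapplyD.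
  apply: (G_quotient_mem t0' ct' cvy).
  by apply: eventually_mono evok' => j oj; have [_ /(_ oj) []] := hy (phi j).
have exy0 mu' : tapply (grad_x A) mu' = xs -> inner mu' (mapply A (vpair vzero y0)) = inner xs y0.
  by move=> <-; rewrite inner_tapply mapply_grad_x.
(* The optimality inequality multiplied by [t] leaves only this in the limit; the opposite sign
   comes from [mu] being polar and [A(0, y0)] lying in [K]. *)
have xy_ge0 : 0 <= 2 * inner xs y0.
  have c1 := CV_mult _ _ _ _ ct' (CV_minus _ _ _ _ (CV_minus _ _ _ _ (cvZ rho (cv_inner cy cy))
     (cvZ 2 (cv_inner (vcv_const w) cy))) cga).
  rewrite Rmult_0_l in c1.
  apply: (cv_le c1 (cvZ 2 (cv_inner (vcv_const xs) cy))).
  apply: eventually_mono I1 => j h; have tj := t0' j.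
  have -> : 2 * inner xs (y (phi j)) = t (phi j) * (2 * (inner xs (y (phi j)) / t (phi j))) by field; lra.
  apply: Rmult_le_compat_l; vlra.
have xy0 : inner xs y0 = 0.
  have := pm _ KAy; rewrite (exy0 _ em); vlra.
have lAy : lin K (mapply A (vpair vzero y0)).
  by apply: (ri_polar_lin clK cvK cnK ri KAy); rewrite (exy0 _ emub).
(* [hys0] removes the term with [ys], which leaves [(2 M + 1) |y0|^2 <= 2 M |y0|^2]. *)
have y00 : y0 = vzero.
  apply: norm_eq0; apply: norm_le_of_sqr; first exact: Rle_refl.
  have h1 := hys0 _ lAy.
  have h2 : - (2 * s0 * inner mu (mapply (dmat T (vpair vzero y0)) (vpair vzero y0))) <= 2 * (M * inner y0 y0).
    move: bM; move: (inner mu _) (inner_ge0 y0) => x q0 bx.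
    have hb : Rabs (s0 * x) <= 1 * (M * inner y0 y0).
      by rewrite Rabs_mult (Rabs_pos_eq s0); [apply: Rmult_le_compat; try vlra; exact: Rabs_pos|lra].
    by move: hb; split_Rabs; vlra.
  by rewrite /rho in hlim2; vlra.

(* The tangent sequence and its proximal normals *)
rewrite y00 in cy cvy.
have cW : vcv (fun j => vpair (vadd (vk (phi j)) (vpair vzero (y (phi j)))) (vsub w (vscale rho (y (phi j)))))
    (vpair v w).
  apply: vcv_vpair.
    by move: cvy; have -> : vadd v (vpair vzero vzero) = v by
      apply: functional_extensionality => -[i|i]; rewrite /vadd /vpair /vzero; unfold reverse_coercion; ring.
  have := vcvB (vcv_const w) (vcvZ (cv_const rho) cy).
  by have -> : vsub w (vscale rho vzero) = w by vring.
apply: (tangent_coneI t0' ct' cW).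
have evy := vcv_eventually cy Rlt_0_1.
apply: eventually_mono (eventually_and evok' evy) => j' [].
rewrite normal_graph_shift; set j := phi j' => oj yj1.
have tj := t0 j.
have evz (x : Vec 'I_n) : vsub x vzero = x by vring.
rewrite evz in yj1.
have [y1 /(_ oj) [Ky hmin]] := hy j.
pose pj := vadd pbar (vscale (t j) (vfst (vk j))).
have -> : vadd pbar (vscale (t j) (vfst (vadd (vk j) (vpair vzero (y j))))) = pj.
  by rewrite /pj; congr (vadd _ (vscale _ _)); apply: functional_extensionality => i;
     rewrite /vfst /vadd /= /vzero; ring.
have ept x : pt j x = vpair pj (vadd xbar (vscale (t j) (vadd (vsnd (vk j)) x))).
  rewrite /pt [vk j in LHS]vpair_eta vpairD zbar_shift; congr vpair.
  by rewrite /pj; vring.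
have -> : vsnd (vadd (vk j) (vpair vzero (y j))) = vadd (vsnd (vk j)) (y j) by [].
set xj := vadd xbar _.
have nj := norm_ge0 (y j).
split; first by apply/GO; rewrite -/(xj) -ept //; apply: oj.1.
(* The first radius keeps the competitor [y'] in the unit ball; the second gives
   [rho N^2 / 2 <= e N] for the quadratic proximal term. *)
move=> e ep; exists (Rmin (t j * (1 - norm (y j))) (2 * e / rho)); split.
  apply: Rmin_glb_lt; first by apply: Rmult_lt_0_compat; vlra.
  by apply: Rdiv_lt_0_compat; lra.
move=> x Ox hx.
have hx1 := Rlt_le_trans _ _ _ hx (Rmin_l _ _).
have hx2 := Rlt_le_trans _ _ _ hx (Rmin_r _ _).
pose y' := vadd (y j) (vscale (/ t j) (vsub x xj)).
have ny' : norm y' <= 1.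
  apply: (Rle_trans _ _ _ (norm_triangle _ _)); rewrite normZ Rabs_pos_eq; last first.
    by apply: Rlt_le; apply: Rinv_0_lt_compat.
  have h : / t j * norm (vsub x xj) <= 1 - norm (y j).
    apply: (Rmult_le_reg_l (t j)) => //; rewrite -Rmult_assoc Rinv_r ?Rmult_1_l; vlra.
  vlra.
have ex' : pt j y' = vpair pj x.
  rewrite ept; congr vpair; apply: functional_extensionality => i.
  rewrite /y' /xj /vadd /vscale /vsub; field; lra.
have Ky' : K (G (pt j y')).
  by apply/(GO (oj.1 _ ny')); rewrite ex'.
have := nearest_point_prox (hmin _ ny' Ky').
have -> : vsub y' (y j) = vscale (/ t j) (vsub x xj) by rewrite /y'; vring.
rewrite !innerZr innerZl => hprox.
have -> : vadd xs (vscale (t j) (vsub w (vscale rho (y j)))) = vscale (rho * t j) (vsub (b j) (y j)).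
  apply: functional_extensionality => i; rewrite /b /vadd /vscale /vsub; field; lra.
rewrite innerZl.
move: hprox; rewrite -norm_sqr; set N := norm (vsub x xj) in hx2 *; set c := inner _ _ => hprox.
have N0 : 0 <= N by exact: norm_ge0.
have h3 : t j * (2 * c) <= N * N.
  have h4 : t j * t j * (2 * (/ t j * c)) <= t j * t j * (/ t j * (/ t j * (N * N))).
    by apply: Rmult_le_compat_l => //; nra.
  have E1 : t j * t j * (2 * (/ t j * c)) = t j * (2 * c) by field; lra.
  have E2 : t j * t j * (/ t j * (/ t j * (N * N))) = N * N by field; lra.
  by rewrite E1 E2 in h4.
have h5 : rho * N <= 2 * e.
  have -> : 2 * e = rho * (2 * e / rho) by field; lra.
  by apply: Rmult_le_compat_l; [lra|exact: Rlt_le].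
have h6 : rho * (t j * (2 * c)) <= rho * (N * N) by apply: Rmult_le_compat_l; lra.
have h7 : N * (rho * N) <= N * (2 * e) by apply: Rmult_le_compat_l.
lra.
Qed.
End Reduced.

Theorem theorem4p4 (m n l d : nat)
  (g : Vec (ZI m n) -> Vec 'I_l) (pbar : Vec 'I_m) (xbar : Vec 'I_n)
  (C : Vec 'I_l -> Prop) (K : Vec 'I_d -> Prop)
  (V : Vec 'I_l -> Prop) (h : Vec 'I_l -> Vec 'I_d)
  (xsbar : Vec 'I_n)
  (DG : Vec (ZI m n) -> Mat 'I_d (ZI m n))
  (D2G : Vec (ZI m n) -> 'I_d -> ZI m n -> ZI m n -> R) :
  (* g is C^2 around zbar = (pbar, xbar) *)
  (exists Dg D2g, C2_around g (vpair pbar xbar) Dg D2g) ->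
  (* C closed, C^2-cone reducible at g(zbar) to the closed convex cone K via (V, h) *)
  is_closed C -> is_closed K -> is_convex K -> is_cone K ->
  is_open V -> V (g (vpair pbar xbar)) ->
  (exists Dh D2h, C2_on V h Dh D2h /\ surjective_mat (Dh (g (vpair pbar xbar)))) ->
  (forall i, h (g (vpair pbar xbar)) i = 0) ->
  (forall y, V y -> (C y <-> K (h y))) ->
  (* DG, D2G are the first and second derivatives of G := h o g around zbar *)
  C2_around (fun z => h (g z)) (vpair pbar xbar) DG D2G ->
  (* xbar in Gamma(pbar), xsbar in N_{Gamma(pbar)}(xbar) *)
  C (g (vpair pbar xbar)) ->
  reg_normal (Gamma C g pbar) xbar xsbar ->
  (* Robinson stability and strict complementarity *)
  robinson_stable (fun z => h (g z)) K pbar xbar ->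
  strict_compl K (DG (vpair pbar xbar)) xsbar ->
  (* inclusion *)
  (forall (q : Vec 'I_m) (u : Vec 'I_n) (w : Vec 'I_n),
     char_subspace K (DG (vpair pbar xbar)) q ->
     DPsi C g (vpair pbar xbar) xsbar (vpair q u) w ->
     exists (zs : Vec (ZI m n)) (mu : Vec 'I_d) (ys : Vec (ZI m n)),
       reg_normal (tangent_cone (gphGamma C g) (vpair pbar xbar)) (vpair q u) zs /\
       (forall j, vsnd zs j = xsbar j) /\
       multipliers K (DG (vpair pbar xbar)) zs mu /\
       reg_normal (crit_cone (gphGamma C g) (vpair pbar xbar) zs) (vpair q u) ys /\
       (forall j, w j = hess_x_mult (D2G (vpair pbar xbar)) mu (vpair q u) j + vsnd ys j))
  /\
  (* equality under the second-order condition *)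
  (forall (q : Vec 'I_m) (u : Vec 'I_n),
     char_subspace K (DG (vpair pbar xbar)) q ->
     in_rge_plus_lin (DG (vpair pbar xbar)) K (hess_vv (D2G (vpair pbar xbar)) (vpair q u)) ->
     forall (w : Vec 'I_n),
       DPsi C g (vpair pbar xbar) xsbar (vpair q u) w <->
       exists (zs : Vec (ZI m n)) (mu : Vec 'I_d) (ys : Vec (ZI m n)),
         reg_normal (tangent_cone (gphGamma C g) (vpair pbar xbar)) (vpair q u) zs /\
         (forall j, vsnd zs j = xsbar j) /\
         multipliers K (DG (vpair pbar xbar)) zs mu /\
         reg_normal (crit_cone (gphGamma C g) (vpair pbar xbar) zs) (vpair q u) ys /\
         (forall j, w j = hess_x_mult (D2G (vpair pbar xbar)) mu (vpair q u) j + vsnd ys j)).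
Proof.
move=> [Dg [D2g [dg [dg0 Cg]]]] _ clK cvK cnK oV Vg _ h0 CK [dG [dG0 CG]] Cz _ RS [mub [ri emub']].
pose zbar := vpair pbar xbar; pose G z := h (g z).
have zz r : 0 < r -> norm (vsub zbar zbar) < r.
  by have -> : vsub zbar zbar = vzero; [vring|rewrite norm0].
have [Dgz _] := Cg zbar (zz _ dg0).
have [_ [G2 _]] := CG zbar (zz _ dG0).
have [ev [ev0 hev]] := oV _ Vg.
have [d1 [d10 hd1]] := fderiv_calm Dgz.
pose Lg := norm (mat2vec (Dg zbar)) + 1.
have Lg0 : 0 < Lg by have := norm_ge0 (mat2vec (Dg zbar)); rewrite /Lg; vlra.
(* The radii ensure, in turn, smoothness of [G], calmness of [g] with constant [Lg], and that
   calmness places [g z] in the [ev]-ball inside [V]. *)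
pose de := Rmin dG (Rmin d1 (ev / Lg)).
have de0 : 0 < de.
  by apply: Rmin_glb_lt => //; apply: Rmin_glb_lt => //; exact: Rdiv_lt_0_compat.
have G1 z : norm (vsub z zbar) < de -> fderiv G z (DG z).
  by move=> hz; have [] := CG z (Rlt_le_trans _ _ _ hz (Rmin_l _ _)).
have GO z : norm (vsub z zbar) < de -> (gphGamma C g z <-> K (G z)).
  move=> hz; apply: CK; apply: hev.
  have hz' := Rlt_le_trans _ _ _ hz (Rmin_r _ _).
  apply: (Rle_lt_trans _ _ _ (hd1 z (Rlt_le_trans _ _ _ hz' (Rmin_l _ _)))).
  have -> : ev = Lg * (ev / Lg) by field; lra.
  by apply: Rmult_lt_compat_l => //; exact: Rlt_le_trans hz' (Rmin_r _ _).
have G0 : G zbar = vzero by apply: functional_extensionality.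
have emub : tapply (grad_x (DG zbar)) mub = xsbar by apply: functional_extensionality.
have formulaP v w : derivative_formula DG (D2G zbar) K (gphGamma C g) pbar xbar xsbar v w <-> 
  exists (zs : Vec (ZI m n)) (mu : Vec 'I_d) (ys : Vec (ZI m n)),
       reg_normal (tangent_cone (gphGamma C g) (vpair pbar xbar)) v zs /\
       (forall j, vsnd zs j = xsbar j) /\
       multipliers K (DG (vpair pbar xbar)) zs mu /\
       reg_normal (crit_cone (gphGamma C g) (vpair pbar xbar) zs) v ys /\
       (forall j, w j = hess_x_mult (D2G (vpair pbar xbar)) mu v j + vsnd ys j).
  split=> [[zs [mu [ys [h1 h2 [h3 h4] h5 h6]]]]|[zs [mu [ys [h1 [h2 [[h3 h4] [h5 h6]]]]]]]].
    exists zs, mu, ys; split=> //; split; first by rewrite h2.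
    by split; [split=> // i; rewrite h4|split=> // j; rewrite h6].
  by exists zs, mu, ys; split=> //; [|split=> //|]; exact: functional_extensionality.
have incl q u w : char_subspace K (DG zbar) q -> DPsi C g zbar xsbar (vpair q u) w ->
    derivative_formula DG (D2G zbar) K (gphGamma C g) pbar xbar xsbar (vpair q u) w.
  move=> cq hw; exact: (derivative_subset de0 G1 G2 GO G0 clK cvK cnK RS ri emub cq hw).
split=> [q u w cq hw|q u cq hess w]; first by apply/formulaP; exact: incl.
split=> [hw|/formulaP hw]; first by apply/formulaP; exact: incl.
exact: (derivative_superset de0 G1 G2 GO G0 clK cvK cnK RS ri emub cq hess hw).
Qed.
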